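(* For any set $X\subseteq2^\omega$, the following are equivalent: (i) $X$ is $\mathcal P$-null; (ii) $X$ is $\mathcal N$-additive; (iii) $X$ is sharply $\mathcal N$-additive; (iv) $\mathcal H^1(X\times N)=0$ for each $N\in\mathcal N$.
   Context: $2^\omega$ is the Cantor cube, a compact group under coordinatewise addition mod 2, with metric $d(x,y)=2^{-n(x,y)}$ for $x\neq y$, where $n(x,y)=\min\{i:x(i)\ne y(i)\}$; $\mu$ is its Haar (= product) measure and $\mathcal N$ is the ideal of $\mu$-null sets. $A+B=\{a+b:a\in A,b\in B\}$. $X\subseteq2^\omega$ is $\mathcal N$-additive if $X+N\in\mathcal N$ for every $N\in\mathcal N$; it is sharply $\mathcal N$-additive if for every $N\in\mathcal N$ there is a $\sigma$-compact set $F\supseteq X$ (in $2^\omega$) with $F+N\in\mathcal N$. $\mathcal H^1$ is the 1-dimensional Hausdorff (outer) measure; products of metric spaces carry the maximum metric. $N_X(\delta)$ is the minimal number of sets of diameter at most $\delta$ needed to cover $X$ ($\infty$ if no finite number suffices); $\overline{\dim}_B X=\limsup_{\delta\to0}\frac{\log N_X(\delta)}{|\log\delta|}$ ($0$ for the empty set); the upper packing dimension is $\overline{\dim}_P X=\inf\{\sup_n\overline{\dim}_B X_n\}$ over all countable covers $\{X_n\}$ of $X$. A separable metric space $X$ is $\mathcal P$-null if $\overline{\dim}_P f(X)=0$ for every uniformly continuous map $f$ from $X$ into a metric space. Subsets of $2^\omega$ carry the inherited metric. *)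

(* Defs.v *)
From HB Require Import structures.
From mathcomp Require Import all_boot all_order all_algebra finmap.
From mathcomp Require Import all_classical all_reals all_analysis.

Set Implicit Arguments.
Unset Strict Implicit.
Unset Printing Implicit Defensive.
Import Order.TTheory GRing.Theory Num.Theory.
Import numFieldTopology.Exports numFieldNormedType.Exports.

Local Open Scope classical_set_scope.
Local Open Scope ring_scope.

(* A copy of [cantor_space], so that the metric below is the only one that
   unification can find. *)
Definition cantor_cube : Type := cantor_space.

HB.instance Definition _ := Pointed.copy cantor_cube cantor_space.
HB.instance Definition _ := Uniform.copy cantor_cube cantor_space.

(* The group law of the cube: coordinatewise addition modulo 2. *)
Definition cantor_add (x y : cantor_cube) : cantor_cube :=
  fun i => x i (+) y i.

Definition sumset (A B : set cantor_cube) : set cantor_cube :=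
  [set cantor_add x y | x in A & y in B].

Lemma fset_bounded (K : choiceType) (F : {fset K}) (f : K -> nat) :
  exists n, forall p, p \in F -> (f p <= n)%N.
Proof.
by exists (\max_(p <- enum_fset F) f p)%N => p pF; exact: leq_bigmax_seq.
Qed.

Lemma entourage_coord (i : nat) :
  @entourage cantor_cube [set xy | xy.1 i = xy.2 i].
Proof.
pose E : set (cantor_space * cantor_space) := [set xy | xy.1 i = xy.2 i].
have entE : @entourage (initial_topology (@proj nat (fun=> bool) i)) E.
  exists [set xy : bool * bool | xy.1 = xy.2]; last by [].
  rewrite uniform_discrete /discrete_ent.
  by move=> _ [x _ <-].
exists E; last by [].
have entE' := asboolT entE.
exact: (finI_from1 _ (i := exist _ ((i : {classic nat}), E) entE')).
Qed.

Lemma entourage_prefix (n : nat) : @entourage cantor_cube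
  [set xy | forall i, (i < n)%N -> xy.1 i = xy.2 i].
Proof.
have FE : Filter (@entourage cantor_cube) by exact: entourage_filter.
elim: n => [|m IH]; first by apply: (@filterS _ _ FE setT); last exact: filterT.
apply: filterS (filterI IH (entourage_coord m)) => -[x y]/= [H xym] i.
by rewrite ltnS leq_eqVlt => /predU1P[->//|/H].
Qed.

Section cantor_metric.
Context {R : realType}.
Implicit Types (x y z : cantor_cube) (n : nat).

Definition cantor_dist x y : R :=
  if pselect (exists i : nat, x i != y i) is left neq_xy
  then 2^-1 ^+ ex_minn neq_xy else 0.

Lemma cantor_dist_ge0 x y : 0 <= cantor_dist x y.
Proof. by rewrite /cantor_dist; case: pselect => // h; rewrite exprn_ge0. Qed.

Lemma lt_half_exp m n : ((2^-1 : R) ^+ m < 2^-1 ^+ n) = (n < m)%N.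
Proof.
by apply: ltr_iXn2l; rewrite ?invr_gt0 ?invf_lt1 ?ltr0n ?ltr1n.
Qed.

Lemma cantor_dist_lt x y n :
  cantor_dist x y < 2^-1 ^+ n <-> forall i, (i <= n)%N -> x i = y i.
Proof.
rewrite /cantor_dist; case: pselect => [h|h].
  case: ex_minnP => m xym minm; rewrite lt_half_exp; split=> [nm i ni|H].
    apply/eqP; apply: contraLR nm => /minm mi.
    by rewrite -leqNgt (leq_trans mi).
  by rewrite ltnNge; apply: contra xym => /H ->.
split=> [_ i _|_]; last by rewrite exprn_gt0 ?invr_gt0.
by apply/eqP; apply/negPn/negP => xyi; apply: h; exists i.
Qed.

Lemma cantor_dist_positivity x y : cantor_dist x y = 0 -> x = y.
Proof.
move=> xy0; apply/funext => i.
have /cantor_dist_lt/(_ i (leqnn i))// : cantor_dist x y < 2^-1 ^+ i.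
by rewrite xy0 exprn_gt0 ?invr_gt0.
Qed.

Lemma cantor_distxx x : cantor_dist x x = 0.
Proof.
rewrite /cantor_dist; case: pselect => // h; exfalso.
by case: h => i; rewrite eqxx.
Qed.

Lemma cantor_dist_ultra x y z e :
  cantor_dist x y < e -> cantor_dist y z < e -> cantor_dist x z < e.
Proof.
rewrite {3}/cantor_dist; case: pselect => [h|_ xye _]; last first.
  exact: le_lt_trans (cantor_dist_ge0 _ _) xye.
case: ex_minnP => m xzm _; rewrite !ltNge => xy yz; apply/negP => em.
have /cantor_dist_lt/(_ m (leqnn m)) xym : cantor_dist x y < 2^-1 ^+ m.
  by rewrite (lt_le_trans _ em)// ltNge.
have /cantor_dist_lt/(_ m (leqnn m)) yzm : cantor_dist y z < 2^-1 ^+ m.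
  by rewrite (lt_le_trans _ em)// ltNge.
by rewrite xym yzm eqxx in xzm.
Qed.

Lemma cantor_dist_sym x y : cantor_dist x y = cantor_dist y x.
Proof.
wlog xy : x y / cantor_dist x y < cantor_dist y x => [H|].
  by case: (ltgtP (cantor_dist x y) (cantor_dist y x)) => // /H.
move: (xy); rewrite {2}/cantor_dist; case: pselect => [h|_]; last first.
  by rewrite ltNge cantor_dist_ge0.
case: ex_minnP => m yxm _ /cantor_dist_lt/(_ m (leqnn m)) xym.
by rewrite xym eqxx in yxm.
Qed.

Definition cantor_ball x (e : R) : set cantor_cube :=
  [set y | cantor_dist x y < e].

Let cantor_ball_center x (e : R) : 0 < e -> cantor_ball x e x.
Proof. by move=> e0; rewrite /cantor_ball/= cantor_distxx. Qed.

Let cantor_ball_sym x y (e : R) : cantor_ball x e y -> cantor_ball y e x.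
Proof. by rewrite /cantor_ball/= cantor_dist_sym. Qed.

Let cantor_ball_triangle x y z (e1 e2 : R) :
  cantor_ball x e1 y -> cantor_ball y e2 z -> cantor_ball x (e1 + e2) z.
Proof.
rewrite /cantor_ball/= => xy yz.
have e10 := le_lt_trans (cantor_dist_ge0 _ _) xy.
have e20 := le_lt_trans (cantor_dist_ge0 _ _) yz.
apply: (@cantor_dist_ultra x y).
  by rewrite (lt_le_trans xy)// lerDl ltW.
by rewrite (lt_le_trans yz)// lerDr ltW.
Qed.

Let cantor_entourageE : entourage = entourage_ cantor_ball.
Proof.
apply/seteqP; split => [E|E [e /= e0 eE]].
  move=> [B [F _ <-] FE].
  have [n Fn] := fset_bounded F (fun p => (projT1 p).1).
  exists (2^-1 ^+ n); first by rewrite /= exprn_gt0 ?invr_gt0.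
  move=> [x y] /= /cantor_dist_lt xy; apply: FE => p pF.
  have := Fn p pF; case: p {pF} => -[i W] /= /asboolP[V entV VW] ni.
  apply: VW; change (V (x i, y i)).
  by rewrite (xy _ ni); exact: entourage_refl.
have [n ne] : exists n, 2^-1 ^+ n < e.
  have /cvgrPdist_lt/(_ e e0)[n _ /(_ n (leqnn n))] :=
    @cvg_expr R 2^-1 (ltac:(by rewrite ger0_norm ?invf_lt1 ?ltr1n)).
  by rewrite sub0r normrN ger0_norm ?exprn_ge0//; exists n.
have FE : Filter (@entourage cantor_cube) by exact: entourage_filter.
apply: filterS (entourage_prefix n.+1) => -[x y]/= H.
by apply: eE; apply: lt_trans ne; apply/cantor_dist_lt.
Qed.

HB.instance Definition _ := Uniform_isPseudoMetric.Build R cantor_cube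
  cantor_ball_center cantor_ball_sym cantor_ball_triangle cantor_entourageE.

HB.instance Definition _ := PseudoMetric_isMetric.Build R cantor_cube
  cantor_dist_ge0 cantor_dist_positivity (fun _ _ => erefl).

End cantor_metric.

(* The maximum metric on products, and the inherited metric on subsets. *)
Section metric_constructions.
Context {R : realType}.

Definition prod_dist (U V : metricType R) (x y : U * V) : R :=
  Num.max (mdist x.1 y.1) (mdist x.2 y.2).

Let prod_dist_ge0 U V x y : 0 <= @prod_dist U V x y.
Proof. by rewrite le_max mdist_ge0. Qed.

Let prod_dist_positivity U V x y : @prod_dist U V x y = 0 -> x = y.
Proof.
case: x y => [x1 x2] [y1 y2]; rewrite /prod_dist/= => xy0.
have := lexx (0 : R); rewrite -{1}xy0 ge_max => /andP[xy1 xy2].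
by congr pair; apply: mdist_positivity; apply/eqP;
  rewrite eq_le mdist_ge0 ?xy1 ?xy2.
Qed.

Let ball_prod_dist U V x e : ball x e = [set y | @prod_dist U V x y < e].
Proof.
apply/seteqP; split => y.
  by case; rewrite !ballEmdist/= /prod_dist gt_max => -> ->.
by rewrite /= /prod_dist gt_max => /andP[? ?]; split; rewrite ballEmdist.
Qed.

HB.instance Definition _ (U V : metricType R) :=
  PseudoMetric_isMetric.Build R (U * V)%type
    (@prod_dist_ge0 U V) (@prod_dist_positivity U V) (@ball_prod_dist U V).

Definition sub_dist (T : metricType R) (A : set T) (x y : A) : R :=
  mdist (val x) (val y).

Let sub_dist_ge0 T A x y : 0 <= @sub_dist T A x y.
Proof. exact: mdist_ge0. Qed.

Let sub_dist_positivity T A x y : @sub_dist T A x y = 0 -> x = y.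
Proof. by move/mdist_positivity/val_inj. Qed.

Let ball_sub_dist (T : metricType R) (A : set T) (x : A) (e : R) :
  ball x e = [set y : A | sub_dist x y < e].
Proof. by rewrite -initial_ballE ballEmdist. Qed.

HB.instance Definition _ (T : metricType R) (A : set T) :=
  PseudoMetric_isMetric.Build R (set_type A)
    (@sub_dist_ge0 T A) (@sub_dist_positivity T A) (@ball_sub_dist T A).

End metric_constructions.

(* [A] depends only on the first [n] coordinates. *)
Definition cantor_level (n : nat) (A : set cantor_cube) : Prop :=
  forall x y, (forall i, (i < n)%N -> x i = y i) -> A x -> A y.

Lemma cantor_levelW m n A : (m <= n)%N -> cantor_level m A -> cantor_level n A.
Proof.
by move=> mn mA x y xy; apply: mA => i im; apply: xy; exact: leq_trans mn.
Qed.

Definition cantor_clopen (A : set cantor_cube) : Prop :=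
  exists n, cantor_level n A.

Lemma cantor_clopen0 : cantor_clopen set0. Proof. by exists 0%N. Qed.

Lemma cantor_clopenU : setU_closed cantor_clopen.
Proof.
move=> A B [m mA] [n nB]; exists (maxn m n) => x y xy [Ax|Bx].
  by left; apply: (cantor_levelW (leq_maxl m n) mA) Ax.
by right; apply: (cantor_levelW (leq_maxr m n) nB) Bx.
Qed.

Lemma cantor_clopenC : setC_closed cantor_clopen.
Proof.
move=> A [n nA]; exists n => x y xy Ax Ay; apply: Ax.
by apply: nA Ay => i ni; rewrite xy.
Qed.

(* A copy of the cube whose measurable sets are the finite unions of
   cylinders. *)
Definition cantor_alg : Type := cantor_cube.

HB.instance Definition _ := Pointed.copy cantor_alg cantor_cube.
HB.instance Definition _ := isAlgebraOfSets.Build default_measure_display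
  cantor_alg cantor_clopen0 cantor_clopenU cantor_clopenC.

Lemma cantor_clopen_open (A : set cantor_cube) : cantor_clopen A -> open A.
Proof.
move=> [n nA]; rewrite openE => x Ax.
apply/nbhsP; eexists; first exact: (entourage_prefix n).
by move=> y /xsectionP/= xy; apply: nA Ax.
Qed.

Definition cantor_ext (n : nat) (s : n.-tuple bool) : cantor_cube :=
  fun i => nth false s i.

Section content.
Context {R : realType}.

(* The proportion, among the [2 ^ n] points with zeros from the index [n] on,
   of those that lie in [A]. *)
Definition cantor_ratio (n : nat) (A : set cantor_cube) : R :=
  #|[pred s : n.-tuple bool | `[< A (cantor_ext s) >]]|%:R / 2 ^+ n.

Definition cantor_content (A : set cantor_alg) : \bar R :=
  (cantor_ratio (xget 0%N [set n | cantor_level n A]) A)%:E.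

Lemma cantor_ratioS n A : cantor_level n A ->
  cantor_ratio n.+1 A = cantor_ratio n A.
Proof.
pose W k := [set s : k.-tuple bool | `[< A (cantor_ext s) >]]%SET.
have WE k : #|[pred s : k.-tuple bool | `[< A (cantor_ext s) >]]| = #|W k|.
  by rewrite cardsE.
move=> nA; rewrite /cantor_ratio !WE.
set S := W n.+1; set T := W n.
have -> : #|S| = (2 * #|T|)%N.
  pose f (p : bool * n.-tuple bool) : n.+1.-tuple bool := [tuple of rcons p.2 p.1].
  have f_inj : injective f.
    move=> [a s] [b t] /(congr1 val)/= /rcons_inj[st ->].
    by congr pair; apply: val_inj.
  have -> : S = (f @: finset.setX finset.setT T)%SET.
    apply/setP => s; apply/idP/imsetP.
      rewrite inE => /asboolP As.
      have sz : size (take n s) == n by rewrite size_takel// size_tuple.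
      have sE : s = f (nth false s n, Tuple sz).
        apply: val_inj; rewrite /= -take_nth ?size_tuple//.
        by rewrite take_oversize// size_tuple.
      exists (nth false s n, Tuple sz) => //; rewrite !inE/=; apply/asboolP.
      apply/asboolP; apply: (nA (cantor_ext s)) => // i ni.
      by rewrite /cantor_ext/= nth_take.
    move=> [[b t]]; rewrite !inE/= => /asboolP/asboolP At ->.
    apply: nA At => i ni; rewrite /cantor_ext/= nth_rcons.
    by rewrite size_tuple ni.
  by rewrite card_imset// cardsX cardsT card_bool.
by rewrite natrM exprS invfM mulrACA mulfV ?mul1r ?pnatr_eq0.
Qed.

Lemma cantor_ratio_le m n A : cantor_level m A -> (m <= n)%N ->
  cantor_ratio n A = cantor_ratio m A.
Proof.
move=> mA /subnK <-; elim: (n - m)%N => // k IH.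
by rewrite addSn cantor_ratioS//; exact: cantor_levelW (leq_addl _ _) mA.
Qed.

Lemma cantor_contentE n A : cantor_level n A ->
  cantor_content A = (cantor_ratio n A)%:E.
Proof.
move=> nA; rewrite /cantor_content; case: xgetP => [m _ mA|/(_ n)//].
by rewrite -(cantor_ratio_le nA (leq_maxr m n))
           -(cantor_ratio_le mA (leq_maxl m n)).
Qed.

Lemma cantor_content0 : cantor_content set0 = 0%E.
Proof.
rewrite (@cantor_contentE 0)// /cantor_ratio (_ : #|_| = 0%N) ?mul0r//.
by apply: eq_card0 => s; rewrite inE; apply/asboolP.
Qed.

Lemma cantor_content_ge0 A : (0 <= cantor_content A)%E.
Proof. by rewrite lee_fin divr_ge0. Qed.

Lemma cantor_contentU (A B : set cantor_alg) :
  cantor_clopen A -> cantor_clopen B -> A `&` B = set0 ->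
  cantor_content (A `|` B) = (cantor_content A + cantor_content B)%E.
Proof.
move=> [m mA] [n nB] AB0; set k := maxn m n.
have kA : cantor_level k A by exact: cantor_levelW (leq_maxl m n) mA.
have kB : cantor_level k B by exact: cantor_levelW (leq_maxr m n) nB.
have kAB : cantor_level k (A `|` B).
  by move=> x y xy [/(kA _ _ xy)|/(kB _ _ xy)]; [left|right].
rewrite (cantor_contentE kA) (cantor_contentE kB) (cantor_contentE kAB).
rewrite -EFinD -mulrDl -natrD -cardUI; congr (_ %:R / _)%:E.
rewrite [X in (_ + X)%N]eq_card0 ?addn0.
  by apply: eq_card => s; rewrite !inE; apply/asboolP/orP;
    (case=> /asboolP; [left|right]).
move=> s; rewrite !inE; apply/negP => /andP[/asboolP As /asboolP Bs].
by suff : (A `&` B) (cantor_ext s) by rewrite AB0.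
Qed.

Lemma cantor_content_sigma_additive : semi_sigma_additive cantor_content.
Proof.
move=> F mF tF mUF.
have [N FN] : exists N, forall i, (N <= i)%N -> F i = set0.
  have cU : compact (\bigcup_i F i : set cantor_cube).
    apply: (@subclosed_compact cantor_cube _ setT) => //.
      rewrite -openC; apply: cantor_clopen_open; exact: cantor_clopenC.
    exact: cantor_space_compact.
  rewrite compact_cover in cU.
  have opF i : [set: nat] i -> open (F i : set cantor_cube).
    by move=> _; exact/cantor_clopen_open/mF.
  have [D _ UD] := cU nat setT _ opF (@subset_refl _ _).
  have [N DN] := fset_bounded D id.
  exists N.+1 => i Ni; rewrite -subset0 => x Fix.
  have [|j /= jD Fjx] := UD x; first by exists i.
  have ij : i = j by apply: (tF i j) => //; exists x.
  by have := DN j jD; rewrite -ij leqNgt Ni.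
have clS n : cantor_clopen (\big[setU/set0]_(i < n) F i).
  by elim/big_ind : _ => [||i _]; [exact: cantor_clopen0
    |exact: cantor_clopenU|exact: mF].
have sumE n : (\sum_(0 <= i < n) cantor_content (F i))%E =
    cantor_content (\big[setU/set0]_(i < n) F i).
  elim: n => [|n IH]; first by rewrite big_geq// big_ord0 cantor_content0.
  rewrite big_nat_recr//= big_ord_recr/= IH.
  rewrite (cantor_contentU (clS n) (mF n))//.
  rewrite -subset0 => x [/=]; rewrite -bigcup_mkord => -[i /= ni Fix Fnx].
  have in_ : i = n by apply: (tF i n) => //; exists x.
  by rewrite in_ ltnn in ni.
apply: cvg_near_cst; exists N => // n /= Nn; rewrite sumE; congr cantor_content.
rewrite -bigcup_mkord; apply/seteqP; split => x [i /= ni Fix]; exists i => //=.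
by rewrite ltnNge; apply/negP => /(leq_trans Nn)/FN Fi0; rewrite Fi0 in Fix.
Qed.

HB.instance Definition _ := isMeasure.Build _ cantor_alg R cantor_content
  cantor_content0 cantor_content_ge0 cantor_content_sigma_additive.

(* A measure on the sigma-algebra generated by the cylinders. [haar_cylinder],
   [haarT] and [haar_add] identify it as the product of the fair coin measures
   and as the Haar probability of the cube. *)
Definition haar := measure_extension cantor_content.
HB.instance Definition _ := Measure.on haar.

Lemma haarE n A : cantor_level n A -> haar A = (cantor_ratio n A)%:E.
Proof.
move=> nA; rewrite /haar /measure_extension measurable_mu_extE.
  exact: cantor_contentE.
by exists n.
Qed.

Lemma haar_cylinder n (x : cantor_cube) :
  haar [set y : cantor_cube | forall i, (i < n)%N -> y i = x i] =
  (2 ^- n)%:E.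
Proof.
rewrite (@haarE n) => [|y z yz yx i ni]; last by rewrite -yz ?yx.
congr EFin; rewrite /cantor_ratio (_ : #|_| = 1%N) ?mul1r//.
rewrite -(card1 [tuple x i | i < n]); apply: eq_card => s; rewrite !inE.
apply/asboolP/eqP => [H|-> i ni].
  apply: eq_from_tnth => i; rewrite tnth_mktuple -H//.
  by rewrite (tnth_nth false).
by rewrite /cantor_ext -[i]/(nat_of_ord (Ordinal ni)) -tnth_nth tnth_mktuple.
Qed.

Lemma haarT : haar setT = 1%E.
Proof.
rewrite [RHS](_ : _ = (2 ^- 0)%:E); last by rewrite expr0 invr1.
rewrite -(haar_cylinder 0 (fun=> false)); congr (haar _).
by apply/seteqP; split.
Qed.

HB.instance Definition _ := Measure_isProbability.Build _ _ R haar haarT.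

Lemma cantor_addK x : involutive (cantor_add x).
Proof. by move=> y; apply/funext => i; rewrite /cantor_add addbA addbb. Qed.

Lemma cantor_add_clopen x A :
  cantor_clopen A -> cantor_clopen (cantor_add x @` A).
Proof.
move=> [n nA]; exists n => y z yz [w Aw wy]; exists (cantor_add x z).
  by apply: nA Aw => i ni; rewrite {1}/cantor_add -yz// -wy /cantor_add addbA addbb.
exact: cantor_addK.
Qed.

Lemma cantor_content_add x A : cantor_clopen A ->
  cantor_content (cantor_add x @` A) = cantor_content A.
Proof.
move=> cA; have [n nxA] := cantor_add_clopen x cA; have [m mA] := cA.
have {}nxA := cantor_levelW (leq_maxr m n) nxA.
have {}mA := cantor_levelW (leq_maxl m n) mA.
set k := maxn m n in nxA mA.
rewrite (cantor_contentE nxA) (cantor_contentE mA) /cantor_ratio.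
congr (_%:R / _)%:E.
pose f (s : k.-tuple bool) := [tuple x i (+) tnth s i | i < k].
have fK : involutive f.
  by move=> s; apply: eq_from_tnth => i; rewrite !tnth_mktuple addbA addbb.
have fE s i : (i < k)%N -> cantor_ext (f s) i = cantor_add x (cantor_ext s) i.
  move=> ik; rewrite /cantor_ext /cantor_add.
  by rewrite -[i]/(nat_of_ord (Ordinal ik)) -!tnth_nth tnth_mktuple.
rewrite -[RHS](fintype.card_image (inv_inj fK)); apply: eq_card => s.
apply/idP/mapP => [sxA|[t]]; rewrite ?mem_enum.
  have /asboolP[w Aw wE] := sxA.
  exists (f s); last by rewrite fK.
  rewrite mem_enum; apply/asboolP; apply: mA Aw => i ik.
  by rewrite fE// -wE; apply/esym; exact: (congr1 (@^~ i) (cantor_addK x w)).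
move=> /asboolP At ->; apply/asboolP.
apply: (nxA (cantor_add x (cantor_ext t))); last by exists (cantor_ext t).
by move=> i ik; rewrite fE.
Qed.

Lemma haar_add x A : haar (cantor_add x @` A) = haar A.
Proof.
suff le y B : (haar (cantor_add y @` B) <= haar B)%E.
  apply/eqP; rewrite eq_le le /=.
  have {1}-> : A = cantor_add x @` (cantor_add x @` A); last exact: le.
  apply/seteqP; split => [z Az|_ [_ [z Az <-] <-]]; last by rewrite cantor_addK.
  by exists (cantor_add x z); [exists z|exact: cantor_addK].
apply: le_ereal_inf_tmp => _ [F [mF BF] <-].
apply: ereal_inf_lbound; exists (fun i => cantor_add y @` F i).
  split=> [i|]; first exact/cantor_add_clopen/mF.
  by rewrite -image_bigcup; exact: image_subset.
by apply: eq_eseriesr => i _; exact/cantor_content_add/mF.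
Qed.

End content.

Section metric_notions.
Context {R : realType}.
Local Open Scope ereal_scope.

(* The supremum includes [0] so that the diameter of [set0] is [0]. *)
Definition diam (T : metricType R) (A : set T) : \bar R :=
  ereal_sup (0 |` [set (mdist x y)%:E | x in A & y in A]).

Definition hausdorff1_delta (T : metricType R) (delta : R) (A : set T) :
    \bar R :=
  ereal_inf [set \sum_(0 <= i <oo) diam (E i) | E in
    [set E : (set T)^nat | (forall i, diam (E i) <= delta%:E) /\
                           A `<=` \bigcup_i E i]].

Definition hausdorff1 (T : metricType R) (A : set T) : \bar R :=
  ereal_sup [set hausdorff1_delta delta A | delta in [set d : R | (0 < d)%R]].

Definition covering_number (T : metricType R) (delta : R) (A : set T) :
    \bar R :=
  ereal_inf [set n%:R%:E | n in
    [set n : nat | exists E : 'I_n -> set T,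
       (forall i, diam (E i) <= delta%:E) /\ A `<=` \bigcup_i E i]].

Definition upper_box_dim (T : metricType R) (A : set T) : \bar R :=
  if A == set0 then 0 else
  limf_esup (fun delta => lne (covering_number delta A) / `|ln delta|%:E)
    (0%R : R)^'+.

Definition upper_packing_dim (T : metricType R) (A : set T) : \bar R :=
  ereal_inf [set ereal_sup [set upper_box_dim (E n) | n in setT] | E in
    [set E : (set T)^nat | A `<=` \bigcup_n E n]].

(* A separable [T] is meant; this holds for the subspaces of the cube. *)
Definition P_null (T : metricType R) : Prop :=
  forall (Y : metricType R) (f : T -> Y),
    unif_continuous f -> upper_packing_dim (range f) = 0.

End metric_notions.

Definition haar_null (R : realType) (N : set cantor_cube) : Prop :=
  (@haar R).-negligible N.

Definition sigma_compact (T : topologicalType) (F : set T) : Prop :=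
  exists K : (set T)^nat, (forall n, compact (K n)) /\ F = \bigcup_n K n.

Definition N_additive (R : realType) (X : set cantor_cube) : Prop :=
  forall N, haar_null R N -> haar_null R (sumset X N).

Definition sharply_N_additive (R : realType) (X : set cantor_cube) : Prop :=
  forall N, haar_null R N ->
    exists F : set cantor_cube,
      [/\ sigma_compact F, X `<=` F & haar_null R (sumset F N)].

(* Main.v *)
From HB Require Import structures.
Require Import Defs.
From mathcomp Require Import all_boot all_order all_algebra.
From mathcomp Require Import all_classical all_reals all_analysis.
From mathcomp Require Import ring lra.

Set Implicit Arguments.
Unset Strict Implicit.
Unset Printing Implicit Defensive.
Import Order.TTheory GRing.Theory Num.Theory.
Import numFieldTopology.Exports numFieldNormedType.Exports.

Local Open Scope classical_set_scope.
Local Open Scope ring_scope.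

(* All four properties are equivalent to Shelah's slalom condition, here called
   [narrow]: for every [g] there are sets [P j] of at most [j + 1] words of length
   [g j] such that every point of [X] has its prefix of length [g j] in [P j] for
   all large [j].

   A null set [N] lies in the upper limit of clopen sets [A j], depending on the
   first [g j] coordinates, with [(j + 1) * haar (A j)] summable. If [X] is narrow,
   then [X + N] lies in the upper limit of the sets [[P j] + A j], and [X `*` N] is
   covered by boxes with summable diameters.

   Conversely, let [X] be [N]-additive, and let [N] be the upper limit of sets
   [A n] of measure [2 ^- n] such that the translates of [A n] by points with
   distinct prefixes of length [g n] are independent. A compact set [K] of positive
   measure misses [X + N]. By a Baire category argument, [X] is a countable union of
   pieces [Z] such that, for some relatively open part [U] of [K] of positive
   measure, [U] misses [Z + A n] up to a null set for all large [n]. As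
   [haar U <= (1 - 2 ^- n) ^ h] whenever [Z] has [h] prefixes of length [g n], their
   number is bounded independently of [g] for large [n].

   For [P]-nullness, [X] is mapped identically onto itself with a metric for which
   the points of a ball of radius [2 ^- k] have a common prefix of length [g k];
   packing dimension less than [1] bounds the number of these prefixes. In the
   other direction, [g] is chosen as a modulus of uniform continuity. *)

(** * The Haar measure as an outer measure *)

Section haar_outer.
Context {R : realType}.
Local Open Scope ereal_scope.
Implicit Types A B N : set cantor_cube.
Local Notation haar := (@haar R).

(** The function underlying [haar], viewed as an outer measure so that monotonicity and
    subadditivity apply to arbitrary sets. *)
Definition haar_outer : {outer_measure set cantor_alg -> \bar R} :=
  mu_ext (@cantor_content R : {measure set cantor_alg -> \bar R}).

Lemma haar_ge0 A : 0 <= haar A. Proof. exact: (outer_measure_ge0 haar_outer). Qed.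

Lemma le_haar A B : A `<=` B -> haar A <= haar B.
Proof. exact: (le_outer_measure haar_outer). Qed.

Lemma haarU2 A B : haar (A `|` B) <= haar A + haar B.
Proof. exact: (outer_measureU2 haar_outer). Qed.

Lemma haar_bigcup (F : (set cantor_cube)^nat) :
  haar (\bigcup_n F n) <= \sum_(n <oo) haar (F n).
Proof. exact: (outer_measure_sigma_subadditive haar_outer). Qed.

Lemma haar_bigcup_seq (I : Type) (s : seq I) (F : I -> set cantor_cube) :
  haar (\big[setU/set0]_(i <- s) F i) <= \sum_(i <- s) haar (F i).
Proof.
elim: s => [|i s IH].
  by rewrite !big_nil; have /eqP := outer_measure0 haar_outer; rewrite eq_le => /andP[].
by rewrite !big_cons (le_trans (haarU2 _ _))// leeD2l.
Qed.

Lemma haar_le1 A : haar A <= 1.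
Proof. by rewrite -(@haarT R); exact: le_haar. Qed.

Lemma haar_fin_num A : haar A \is a fin_num.
Proof.
rewrite ge0_fin_numE ?haar_ge0//.
by rewrite (le_lt_trans (haar_le1 A))// ltry.
Qed.

Lemma clopen_measurable A : cantor_clopen A ->
  measurable (A : set (g_sigma_algebraType (@measurable _ cantor_alg))).
Proof. by move=> cA; exact: sub_sigma_algebra. Qed.

(** Carathéodory's criterion for [A]; the set [B] that it splits is arbitrary. *)
Lemma haar_split A B :
  measurable (A : set (g_sigma_algebraType (@measurable _ cantor_alg))) ->
  haar B = haar (B `&` A) + haar (B `&` ~` A).
Proof.
by move=> mA; exact: (@sub_caratheodory _ _ _ (@cantor_content R) _ mA).
Qed.

Lemma haar_cover N (e : R) : (haar N < e%:E) ->
  exists F : (set cantor_cube)^nat, [/\ (forall i, cantor_clopen (F i)),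
    N `<=` \bigcup_i F i & \sum_(i <oo) haar (F i) < e%:E].
Proof.
move=> /ereal_inf_lt[_ [F [mF NF] <-] Fe]; exists F; split => //.
apply: le_lt_trans Fe; apply: lee_nneseries => [i _ _|i _]; first exact: haar_ge0.
have [n nF] := mF i.
by rewrite (haarE nF) -(cantor_contentE nF).
Qed.

(** From right to left, clopen covers of [N] of total measure below [1 / k.+1] are intersected over
    all [k], which gives a measurable null set containing [N]. *)
Lemma haar_nullP N : haar_null R N <-> haar N = 0.
Proof.
split=> [[A [_ A0 NA]]|N0].
  by apply/eqP; rewrite eq_le haar_ge0 andbT -A0 le_haar.
have H (k : nat) : haar N < (k.+1%:R^-1)%:E by rewrite N0 lte_fin invr_gt0.
have {H} /choice[F HF] k := haar_cover (H k).
exists (\bigcap_k \bigcup_i F k i); split.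
- apply: bigcapT_measurable => k; apply: bigcupT_measurable => i.
  by apply: clopen_measurable; have [] := HF k.
- apply/eqP; rewrite eq_le haar_ge0 andbT; apply/lee_addgt0Pr => e e0.
  rewrite add0e; have [k ke] : exists k : nat, (k.+1%:R^-1 < e)%R.
    by exists (Num.trunc e^-1); rewrite invf_plt ?posrE// truncnS_gt.
  have [_ _ Fk] := HF k.
  apply: le_trans (ltW (lt_trans Fk _)); last by rewrite lte_fin.
  by apply: le_trans (haar_bigcup _); apply: le_haar; exact: bigcap_inf.
- by move=> x Nx k _; have [_ NF _] := HF k; exact: NF.
Qed.

End haar_outer.

Lemma nat_pairing : exists p : nat -> nat * nat, set_bij [set: nat] setT p.
Proof.
have /card_esym/card_set_bijP[p pbij] := card_nat2.
by exists p.
Qed.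

Section series.
Context {R : realType}.
Local Open Scope ereal_scope.

Lemma nneseries_pairing (p : nat -> nat * nat) (a : nat * nat -> \bar R) :
  set_bij [set: nat] setT p -> (forall x, 0 <= a x) ->
  \sum_(n <oo) a (p n) = \sum_(i <oo) \sum_(j <oo) a (i, j).
Proof.
move=> pbij a0; rewrite nneseries_esumT//.
rewrite -(reindex_esum setT setT p a)//.
under [RHS]eq_eseriesr do rewrite nneseries_esumT//.
rewrite nneseries_esumT => [|i]; last by rewrite esum_ge0.
rewrite esum_esum// (_ : _ `*`` _ = setT); last by apply/seteqP.
by apply: eq_esum => -[].
Qed.

Lemma nneseries_half (e : R) : (0 <= e)%R ->
  \sum_(i <oo) (e / (2 ^ i.+1)%:R)%:E <= e%:E.
Proof. by move=> e0; have := epsilon_trick0 xpredT e0. Qed.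

End series.

Section blocks.
Variable H : nat -> nat.
Hypothesis H0 : H 0%N = 0%N.
Hypothesis H_lt : forall n, (H n < H n.+1)%N.

Lemma block_le : {homo H : m n / (m <= n)%N}.
Proof. by apply: homo_leq => // [x y z /leq_trans|n]; [apply|exact: ltnW]. Qed.

Lemma blockP (j : nat) : exists n, (H n <= j < H n.+1)%N.
Proof.
elim: j => [|j [n /andP[Hj jH]]]; first by exists 0%N; rewrite H0 /= -{1}H0.
have [jn|nj] := ltnP j.+1 (H n.+1); first by exists n; rewrite (leqW Hj).
by exists n.+1; rewrite nj/=; apply: leq_ltn_trans (H_lt _).
Qed.

End blocks.

(** * Null sets and upper limits of clopen sets *)

Section null_sets.
Context {R : realType}.
Local Open Scope ereal_scope.
Implicit Types N : set cantor_cube.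
Local Notation haar := (@haar R).

(** Covers of [N] by clopen sets, one for each [k] with total measure below [e 0 / 2 ^ k.+1], are
    merged into one summable sequence [C]. Every point of [N] lies in infinitely many terms of [C],
    so the unions [A j] over consecutive blocks of [C] serve, once the blocks start late enough. *)
Lemma null_clopen_sup N (e : nat -> R) : haar N = 0 -> (forall j, (0 < e j)%R) ->
  exists (g : nat -> nat) (A : (set cantor_cube)^nat),
    [/\ (forall j, cantor_level (g j) (A j)),
        (forall j, haar (A j) <= (e j)%:E) &
        N `<=` lim_sup_set A].
Proof.
move=> N0 e_gt0; have [p pbij] := nat_pairing.
have H k : haar N < (e 0%N / (2 ^ k.+1)%:R)%:E.
  by rewrite N0 lte_fin divr_gt0// ltr0n expn_gt0.
have {H} /choice[F HF] k := haar_cover (H k).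
pose C n := F (p n).1 (p n).2.
have clC n : cantor_clopen (C n) by have [+ _ _] := HF (p n).1; apply.
have C_ge0 n : 0 <= haar (C n) by exact: haar_ge0.
have sumC : \sum_(n <oo) haar (C n) <= (e 0%N)%:E.
  rewrite (@nneseries_pairing _ p (fun x => haar (F x.1 x.2)))//.
  apply: le_trans (nneseries_half (ltW (e_gt0 0%N))).
  apply: lee_nneseries => [i _ _|k _]; last by have [_ _ /ltW] := HF k.
  by apply: nneseries_ge0 => *; exact: haar_ge0.
have tailC j : exists M, forall n, (M <= n)%N ->
    \sum_(n <= k <oo) haar (C k) < (e j)%:E.
  have /nneseries_tail_cvg : \sum_(n <oo) haar (C n) < +oo.
    by rewrite (le_lt_trans sumC)// ltry.
  move=> /(_ (fun=> fun=> C_ge0 _)) /fine_cvgP[].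
  case=> M1 _ fin1 /cvgrPdist_lt/(_ _ (e_gt0 j))[M2 _ lt2].
  exists (maxn M1 M2) => n; rewrite geq_max => /andP[/fin1 fn /lt2].
  rewrite /= sub0r normrN => en; rewrite -[ltLHS]fineK// lte_fin.
  by apply: le_lt_trans en; exact: ler_norm.
have /choice[M HM] := tailC.
(* Block [j.+1] starts beyond [M j.+1], where the tail is below [e j.+1]; block 0 is controlled by
   [sumC]. *)
pose i0 j := (\sum_(i < j) (M i.+1).+1)%N.
have i00 : i0 0%N = 0%N by rewrite /i0 big_ord0.
have i0S j : i0 j.+1 = (i0 j + (M j.+1).+1)%N by rewrite /i0 big_ord_recr.
have i0_lt j : (i0 j < i0 j.+1)%N by rewrite i0S addnS ltnS leq_addr.
pose A j := \big[setU/set0]_(i0 j <= n < i0 j.+1) C n.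
have /choice[g gA] j : exists n, cantor_level n (A j).
  by apply: (big_ind cantor_clopen); [exact: cantor_clopen0|exact: cantor_clopenU|].
exists g, A; split => // [j|y Ny J _].
  apply: (@le_trans _ _ (\sum_(i0 j <= n < i0 j.+1) haar (C n))).
    exact: haar_bigcup_seq.
  apply: (@le_trans _ _ (\sum_(i0 j <= k <oo) haar (C k))).
    exact: (@nneseries_lim_ge _ (fun n => haar (C n)) xpredT).
  case: j => [|j]; first by rewrite i00.
  by apply/ltW/HM; rewrite i0S addnS (leq_trans (leq_addl (i0 j) _)).
have [n Jn Cny] : exists2 n, (i0 J <= n)%N & C n y.
  (* A cover whose number exceeds those of all terms before [i0 J] can only contribute terms from
     [i0 J] on. *)
  pose K := (\max_(n < i0 J) (p n).1)%N.
  have [_ /(_ y Ny)[i _ Fy] _] := HF K.+1.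
  have [_ _ /(_ (K.+1, i) I)[n _ pn]] := pbij.
  exists n; last by rewrite /C pn.
  rewrite leqNgt; apply/negP => nJ.
  have : ((p n).1 <= K)%N by exact: (leq_bigmax (Ordinal nJ)).
  by rewrite pn /= ltnn.
have [j /andP[jn nj]] := blockP i00 i0_lt n.
exists j => /=.
  rewrite leqNgt; apply/negP => jJ; have := leq_trans nj (block_le i0_lt jJ).
  by rewrite ltnNge Jn.
rewrite /A -bigcup_seq; exists n => //=.
by rewrite mem_index_iota jn nj.
Qed.

(** The first Borel-Cantelli lemma. *)
Lemma haar_lim_sup_set (A : (set cantor_cube)^nat) :
  (forall j, cantor_clopen (A j)) -> \sum_(j <oo) haar (A j) < +oo ->
  haar (lim_sup_set A) = 0.
Proof.
move=> clA sumA; apply: (@lim_sup_set_cvg0 _ _ _ haar) => // j.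
exact: clopen_measurable.
Qed.

End null_sets.

(** * Shelah's condition *)

Section prefixes.
Implicit Types (x y : cantor_cube) (X : set cantor_cube).

Definition prefix_of x n : seq bool := mkseq x n.

Lemma size_prefix_of x n : size (prefix_of x n) = n.
Proof. exact: size_mkseq. Qed.

Lemma prefix_ofP x y n :
  prefix_of x n = prefix_of y n <-> forall i, (i < n)%N -> x i = y i.
Proof.
split=> [xy i ni|xy]; last by apply/eq_in_map => i; rewrite mem_iota => /xy.
by rewrite -(nth_mkseq false x ni) -(nth_mkseq false y ni) -/(prefix_of _ _) xy.
Qed.

Lemma take_prefix_of x m n : (m <= n)%N -> take m (prefix_of x n) = prefix_of x m.
Proof. by move=> mn; rewrite /prefix_of /mkseq -map_take take_iota (minn_idPl mn). Qed.

(* Shelah's slalom condition, with initial segments in place of the blocks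
   [g j <= i < g j.+1]. *)
Definition narrow X := forall g : nat -> nat, exists P : nat -> seq (seq bool),
  (forall j, (size (P j) <= j.+1)%N) /\
  forall x, X x -> exists J, forall j, (J <= j)%N -> prefix_of x (g j) \in P j.

(* The bound [j.+1] may be replaced by any other one because [g] is arbitrary:
   a prefix of length [g' n] determines the prefixes of length [g j] for the
   whole block of indices [j] between [H n] and [H n.+1]. *)
Lemma narrow_weaken X (h : nat -> nat) :
  (forall g : nat -> nat, exists P : nat -> seq (seq bool),
    (forall j, (size (P j) <= h j)%N) /\
    forall x, X x -> exists J, forall j, (J <= j)%N -> prefix_of x (g j) \in P j) ->
  narrow X.
Proof.
move=> hX g.
(* Block [n.+1] starts at [H n.+1], which exceeds [h n.+1], so [P n.+1] has at most [j.+1] words for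
   every [j] in that block. *)
pose H n := (\sum_(i < n) (h i.+1).+1)%N.
have H0 : H 0%N = 0%N by rewrite /H big_ord0.
have HS n : H n.+1 = (H n + (h n.+1).+1)%N by rewrite /H big_ord_recr.
have H_lt n : (H n < H n.+1)%N by rewrite HS addnS ltnS leq_addr.
have /choice[nu nuP] := blockP H0 H_lt.
have [P [szP XP]] := hX (fun n => \max_(j < H n.+1) g j)%N.
(* On block 0 the size of [P 0] need not fit, and the empty list is taken; only large [j] matter. *)
exists (fun j => if nu j is n.+1 then map (take (g j)) (P n.+1) else [::]).
split=> [j|x /XP[J xP]].
  have := nuP j; case: (nu j) => // n /andP[Hj _].
  rewrite size_map (leq_trans (szP _))// (leq_trans _ (leqW Hj))// HS.
  by rewrite addnS ltnW// ltnS leq_addl.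
exists (H J.+1) => j Jj; have /andP[_ jH] := nuP j.
have Jn : (J < nu j)%N.
  rewrite ltnNge; apply/negP => /(@leq_ltn_trans _ _ J.+1)/(_ (ltnSn _)) nJ.
  by have := leq_trans jH (block_le H_lt nJ); rewrite ltnNge Jj.
case: (nu j) Jn jH => // n Jn jH.
rewrite -(@take_prefix_of x (g j) (\max_(i < H n.+2) g i)); last first.
  exact: (leq_bigmax (Ordinal jH)).
by apply/map_f/xP/ltnW.
Qed.

(* Countably many pieces are merged diagonally: the piece [m] joins the union
   only after the index from which its own bound holds. *)
Lemma narrow_bigcup X (h : nat -> nat) :
  (forall g : nat -> nat, exists Y : (set cantor_cube)^nat,
    X `<=` \bigcup_m Y m /\
    forall m, exists J, forall j, (J <= j)%N -> exists s : seq (seq bool),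
      (size s <= h j)%N /\ forall x, Y m x -> prefix_of x (g j) \in s) ->
  narrow X.
Proof.
move=> hX; apply: (@narrow_weaken _ (fun j => j.+1 * h j)%N) => g.
have [Y [XY /choice[J YJ]]] := hX g.
have /choice[s sP] (mj : nat * nat) : exists s : seq (seq bool),
    (size s <= h mj.2)%N /\
    ((J mj.1 <= mj.2)%N -> forall x, Y mj.1 x -> prefix_of x (g mj.2) \in s).
  have [Jj|_] := leqP (J mj.1) mj.2; last by exists [::].
  by have [s [sh sY]] := YJ mj.1 mj.2 Jj; exists s.
exists (fun j => flatten [seq s (m, j) | m <- iota 0 j.+1]); split=> [j|x].
  rewrite size_flatten /shape -map_comp sumnE big_map.
  apply: (@leq_trans (\sum_(m <- iota 0 j.+1) h j)%N).
    by apply: leq_sum => m _; exact: (sP (m, j)).1.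
  by rewrite big_const_seq count_predT size_iota iter_addn_0 mulnC.
move=> /XY[m _ Ymx]; exists (maxn m (J m)) => j; rewrite geq_max => /andP[mj Jj].
apply/flatten_mapP; exists m; first by rewrite mem_iota.
exact: (sP (m, j)).2.
Qed.

End prefixes.

(** * Consequences for null sets *)

Section additivity.
Context {R : realType}.
Local Open Scope ereal_scope.
Implicit Types X N : set cantor_cube.
Local Notation haar := (@haar R).

Lemma half_power_lt (e : R) : (0 < e)%R -> exists n, (2^-1 ^+ n < e)%R.
Proof.
move=> e0.
have /cvgrPdist_lt/(_ e e0)[n _ /(_ n (leqnn n))] :=
  @cvg_expr R 2^-1%R (ltac:(by rewrite ger0_norm ?invf_lt1 ?ltr1n)).
by rewrite sub0r normrN ger0_norm ?exprn_ge0//; exists n.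
Qed.

Lemma cantor_dist_prefix (x y : cantor_cube) n :
  prefix_of x n = prefix_of y n -> (cantor_dist x y <= 2^-1 ^+ n :> R)%R.
Proof.
move=> /prefix_ofP xy; rewrite /cantor_dist; case: pselect => [h|_]; last first.
  by rewrite exprn_ge0.
case: ex_minnP => m xym _; apply: ler_wiXn2l; rewrite ?invf_le1 ?ler1n//.
by rewrite leqNgt; apply/negP => /xy mE; rewrite mE eqxx in xym.
Qed.

Lemma diam_le (T : metricType R) (A : set T) (d : R) : (0 <= d)%R ->
  (forall x y, A x -> A y -> (mdist x y <= d)%R) -> diam A <= d%:E.
Proof.
move=> d0 Ad; apply: ge_ereal_sup => _ [->|[x Ax [y Ay <-]]]; rewrite lee_fin//.
exact: Ad.
Qed.

Lemma mdist_le_diam (T : metricType R) (A : set T) x y : A x -> A y ->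
  (mdist x y)%:E <= diam A.
Proof. by move=> Ax Ay; apply: ereal_sup_ubound; right; exists x => //; exists y. Qed.

Lemma diam_ge0 (T : metricType R) (A : set T) : 0 <= diam A.
Proof. by apply: ereal_sup_ubound; left. Qed.

(** Chosen so that [j.+1] sets of measure at most [weight j] have total measure at most
    [2 ^- j.+1]. *)
Definition weight (j : nat) : R := j.+1%:R^-1 / (2 ^ j.+1)%:R.

Lemma weight_gt0 j : (0 < weight j)%R.
Proof. by rewrite divr_gt0// ltr0n expn_gt0. Qed.

Lemma mule_weight (k j : nat) (a : \bar R) : (k <= j.+1)%N -> 0 <= a ->
  a <= (weight j)%:E -> k%:R%:E * a <= (1 / (2 ^ j.+1)%:R)%:E.
Proof.
move=> kj a0 aw; apply: (@le_trans _ _ (j.+1%:R%:E * (weight j)%:E)).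
  by apply: lee_pmul => //; rewrite lee_fin ?ler_nat.
by rewrite -EFinM /weight mulrA mulfV// mul1r.
Qed.

(** The sigma-compact set consists of all points whose prefixes eventually lie in [P j]. This is all
    that the estimate of the sumset uses about a point of [X]. *)
Lemma narrow_sharply_N_additive X : narrow X -> sharply_N_additive R X.
Proof.
move=> nX N /haar_nullP N0.
have [g [A [gA Aw NA]]] := null_clopen_sup N0 weight_gt0.
have [P [szP XP]] := nX g.
pose C j := [set x : cantor_cube | prefix_of x (g j) \in P j].
have clC j : cantor_clopen (C j).
  by exists (g j) => x y /prefix_ofP xy; rewrite /C /= xy.
exists (\bigcup_J \bigcap_(j >= J) C j); split.
- exists (fun J => \bigcap_(j >= J) C j); split => // J.
  apply: (@subclosed_compact cantor_cube _ setT) => //; last exact: cantor_space_compact.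
  apply: closed_bigI => j _; rewrite -openC; apply: cantor_clopen_open.
  exact: cantor_clopenC.
- by move=> x /XP[J xP]; exists J => // j /= Jj; exact: xP.
(* Words are padded with zeros to points. As [A j] depends on the first [g j] coordinates only,
   translating it by [x] or by the padded prefix of [x] gives the same set. *)
pose B j := \big[setU/set0]_(s <- P j) (cantor_add (nth false s) @` A j).
apply/haar_nullP/eqP; rewrite eq_le haar_ge0 andbT.
have <- : haar (lim_sup_set B) = 0.
  apply: haar_lim_sup_set => [j|].
    apply: (big_ind cantor_clopen); [exact: cantor_clopen0|exact: cantor_clopenU|].
    by move=> s _; apply: cantor_add_clopen; exists (g j).
  apply: (@le_lt_trans _ _ 1); last exact: ltry.
  apply: le_trans (nneseries_half ler01).
  apply: lee_nneseries => [j _ _|j _]; first exact: haar_ge0.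
  apply: le_trans (haar_bigcup_seq _ _) _.
  under eq_bigr do rewrite haar_add.
  rewrite big_const_seq count_predT (_ : iter _ _ _ = haar (A j) *+ size (P j)); last first.
    exact: iter_addr_0.
  rewrite -mule_natl.
  exact: mule_weight (szP j) (haar_ge0 _) (Aw j).
apply: le_haar => _ [x [J _ xP] [y /NA yA <-]] J' _.
have [j /= Jj Ajy] := yA (maxn J J') I.
move: Jj; rewrite geq_max => /andP[/xP /= Pjx J'j].
exists j => //; rewrite /B -bigcup_seq; exists (prefix_of x (g j)) => //=.
exists (cantor_add (nth false (prefix_of x (g j))) (cantor_add x y)); last first.
  exact: cantor_addK.
apply: gA Ajy => i ij; rewrite /cantor_add nth_mkseq//.
by rewrite addbA addbb.
Qed.

Lemma sharply_N_additiveW X : sharply_N_additive R X -> N_additive R X.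
Proof.
move=> sX N /[dup] nN /sX[F [_ XF]]; apply: negligibleS.
by move=> _ [x Xx [y Ny <-]]; exists x; [exact: XF|exists y].
Qed.

End additivity.

(** * Hausdorff measure of the products with null sets *)

Section hausdorff.
Context {R : realType}.
Local Open Scope ereal_scope.
Implicit Types X N : set cantor_cube.
Local Notation haar := (@haar R).
Local Notation square := (cantor_cube * cantor_cube)%type.

Lemma hausdorff1_delta_ge0 (T : metricType R) (d : R) (A : set T) :
  0 <= hausdorff1_delta d A.
Proof.
apply: le_ereal_inf_tmp => _ [E _ <-]; apply: nneseries_ge0 => i _ _.
exact: diam_ge0.
Qed.

Lemma hausdorff1_eq0P (T : metricType R) (A : set T) :
  hausdorff1 A = 0 <-> forall e : R, (0 < e)%R -> exists E : (set T)^nat,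
    [/\ (forall i, diam (E i) <= e%:E), A `<=` \bigcup_i E i &
        \sum_(i <oo) diam (E i) <= e%:E].
Proof.
split=> [A0 e e0|H].
  have : hausdorff1_delta e A < e%:E.
    apply: (@le_lt_trans _ _ (hausdorff1 A)); last by rewrite A0 lte_fin.
    by apply: ereal_sup_ubound; exists e.
  by move=> /ereal_inf_lt[_ [E [Ed AE] <-] /ltW]; exists E.
apply/eqP; rewrite eq_le; apply/andP; split; last first.
  apply: (@le_trans _ _ (hausdorff1_delta 1 A)).
    exact: hausdorff1_delta_ge0.
  by apply: ereal_sup_ubound; exists 1%R => //=.
apply: ge_ereal_sup => _ [d /= d0 <-]; apply/lee_addgt0Pr => e e0; rewrite add0e.
have [|E [Ed AE sumE]] := H (Num.min d e); first by rewrite lt_min d0.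
apply: (@le_trans _ _ (\sum_(i <oo) diam (E i))).
  apply: ereal_inf_lbound; exists E => //; split => // i.
  by rewrite (le_trans (Ed i))// lee_fin ge_min lexx.
by rewrite (le_trans sumE)// lee_fin ge_min lexx orbT.
Qed.

Lemma mdist_square (u v : square) : mdist u v =
  Num.max (cantor_dist u.1 v.1) (cantor_dist u.2 v.2) :> R.
Proof. by []. Qed.

(** At level [j], at most [j.+1] words for [x] are paired with the [2 ^ g j * haar (A j)] words of
    [A j] for [y]. The boxes have diameter at most [2 ^- g j], so their diameters sum to at most
    [j.+1 * haar (A j)], hence to at most [2 ^- j.+1]. *)
Lemma narrow_hausdorff1 X N : narrow X -> haar_null R N ->
  hausdorff1 (X `*` N : set square) = 0 :> \bar R.
Proof.
move=> nX /haar_nullP N0.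
have [g0 [A [gA0 Aw NA]]] := null_clopen_sup N0 weight_gt0.
(* The maximum with [j] forces the diameters at level [j] down to [2 ^- j]. *)
pose g j := maxn (g0 j) j.
have gA j : cantor_level (g j) (A j) by exact: cantor_levelW (leq_maxl _ _) (gA0 j).
have [P [szP XP]] := nX g.
have [p pbij] := nat_pairing.
apply/hausdorff1_eq0P => e e0; have [J Je] := half_power_lt e0.
pose T j := [seq val t | t : (g j).-tuple bool in
  [pred t : (g j).-tuple bool | `[< A j (cantor_ext t) >]]].
pose L j := [seq (s, t) | s <- P j, t <- T j].
pose box j (st : seq bool * seq bool) : set square :=
  [set u | prefix_of u.1 (g j) = st.1 /\ prefix_of u.2 (g j) = st.2].
(* The pair [(i, k)] stands for box number [k] of level [J + i], and for the empty set past the end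
   of the list. *)
pose F (x : nat * nat) : set square :=
  if (x.2 < size (L (J + x.1)%N))%N
  then box (J + x.1)%N (nth ([::], [::]) (L (J + x.1)%N) x.2) else set0.
have diam_box j st : diam (box j st) <= (2^-1 ^+ g j)%:E :> \bar R.
  apply: diam_le => [|u v [u1 u2] [v1 v2]]; first by rewrite exprn_ge0.
  rewrite mdist_square ge_max !cantor_dist_prefix//; first by rewrite u2.
  by rewrite u1.
have diam_F x : diam (F x) <= (2^-1 ^+ g (J + x.1)%N)%:E :> \bar R.
  rewrite /F; case: ifP => _; first exact: diam_box.
  by apply: diam_le => //; rewrite exprn_ge0.
have half_le m n : (m <= n)%N -> (2^-1 ^+ n <= 2^-1 ^+ m :> R)%R.
  by move=> mn; apply: ler_wiXn2l; rewrite ?invf_le1 ?ler1n.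
exists (fun n => F (p n)); split => [n|[x y] [/= Xx Ny]|].
- apply: le_trans (diam_F _) _; rewrite lee_fin; apply: le_trans (ltW Je).
  by apply: half_le; rewrite /g (leq_trans _ (leq_maxr _ _))// leq_addr.
- have [J' xP] := XP x Xx; have [j /= Jj Ajy] := NA y Ny (maxn J J') I.
  move: Jj; rewrite geq_max => /andP[Jj /xP Pjx].
  have xyL : (prefix_of x (g j), prefix_of y (g j)) \in L j.
    apply/allpairs_f => //; apply/mapP.
    have szy : size (prefix_of y (g j)) == g j by rewrite size_prefix_of.
    exists (Tuple szy) => //; rewrite mem_enum inE; apply/asboolP.
    by apply/asboolP; apply: gA Ajy => i ij; rewrite /cantor_ext /= nth_mkseq.
  have [_ _ /(_ ((j - J)%N, index (prefix_of x (g j), prefix_of y (g j)) (L j)) I)] := pbij.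
  move=> [n _ pn]; exists n => //; rewrite /F pn /= subnKC// index_mem xyL.
  by rewrite nth_index.
rewrite (@nneseries_pairing _ p (fun x => diam (F x)))//; last first.
  by move=> x; exact: diam_ge0.
apply: (@le_trans _ _ (2^-1 ^+ J)%:E); last by rewrite lee_fin ltW.
apply: le_trans (nneseries_half _); last by rewrite exprn_ge0.
apply: lee_nneseries => [i _ _|i _].
  by apply: nneseries_ge0 => *; exact: diam_ge0.
set j := (J + i)%N.
rewrite (nneseries_split 0 (size (L j))); last by move=> *; exact: diam_ge0.
rewrite add0n [X in _ + X]eseries0 ?adde0; last first.
  move=> k jk _; rewrite /F /= ltnNge jk /=; apply/eqP.
  by rewrite eq_le diam_ge0 andbT; exact: diam_le.
apply: (@le_trans _ _ (\sum_(0 <= k < size (L j)) (2^-1 ^+ g j)%:E)).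
  by apply: lee_sum => k _; exact: diam_F.
rewrite sumEFin big_const_nat subn0 iter_addr_0 /L size_allpairs size_map -cardE.
rewrite -[(_ *+ (size _ * _))%R]mulr_natl natrM.
have := mule_weight (szP j) (haar_ge0 (A j)) (Aw j).
rewrite (haarE (gA j)) -EFinM /cantor_ratio mulrA exprVn => /le_trans; apply.
by rewrite lee_fin /j -addnS expnD natrM invfM mulrA div1r exprVn natrX.
Qed.

(** If [2 ^- n.+1 < e <= 2 ^- n], points of [E] agree on the first [n.+1] places in both components,
    so their sums lie in one cylinder of measure [2 ^- n.+1]. *)
Lemma haar_sumset_le (E : set square) (e : R) : (0 < e)%R ->
  (forall u v, E u -> E v -> (mdist u v < e)%R) ->
  haar [set cantor_add u.1 u.2 | u in E] <= e%:E.
Proof.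
move=> e0 Ee; have [->|/set0P[u0 Eu0]] := eqVneq E set0.
  by rewrite image_set0 (_ : haar set0 = 0) ?lee_fin ?ltW//; exact: measure0.
have [e1|e1] := ltP 1%R e; first by rewrite (le_trans (haar_le1 _))// lee_fin ltW.
have [n /andP[en ne]] : exists n, (2^-1 ^+ n.+1 < e <= 2^-1 ^+ n)%R.
  have := half_power_lt e0 => h; case: (ex_minnP h) => -[|n] en minn.
    by move: en; rewrite expr0 ltNge e1.
  by exists n; rewrite en/= leNgt; apply/negP => /minn; rewrite ltnn.
apply: (@le_trans _ _ (2^-1 ^+ n.+1)%:E); last by rewrite lee_fin ltW.
rewrite exprVn -(haar_cylinder n.+1 (cantor_add u0.1 u0.2)).
apply: le_haar => _ [u Eu <-] i ni.
have := Ee _ _ Eu Eu0; rewrite mdist_square gt_max => /andP[].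
move=> /lt_le_trans/(_ ne)/cantor_dist_lt/(_ i ni) u1.
move=> /lt_le_trans/(_ ne)/cantor_dist_lt/(_ i ni) u2.
by rewrite /cantor_add u1 u2.
Qed.

Lemma hausdorff1_N_additive X :
  (forall N, haar_null R N -> hausdorff1 (X `*` N : set square) = 0 :> \bar R) ->
  N_additive R X.
Proof.
move=> HX N /HX/hausdorff1_eq0P XN0; apply/haar_nullP/eqP.
rewrite eq_le haar_ge0 andbT; apply/lee_addgt0Pr => e e0; rewrite add0e.
have [|E [Ed XNE sumE]] := XN0 (e / 2)%R; first by rewrite divr_gt0.
have fin_E i : diam (E i) \is a fin_num.
  by rewrite ge0_fin_numE ?diam_ge0// (le_lt_trans (Ed i))// ltry.
(* Slightly more than the diameter, since [haar_sumset_le] asks for a positive and strict bound; the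
   excesses add up to at most [e / 2]. *)
pose r i := (fine (diam (E i)) + e / 2 / (2 ^ i.+1)%:R)%R.
have e2_gt0 i : (0 < e / 2 / (2 ^ i.+1)%:R)%R.
  by rewrite !divr_gt0// ltr0n expn_gt0.
have r_gt0 i : (0 < r i)%R by rewrite ltr_wpDl// fine_ge0// diam_ge0.
apply: (@le_trans _ _ (\sum_(i <oo) (r i)%:E)).
  apply: (@le_trans _ _ (haar (\bigcup_i [set cantor_add u.1 u.2 | u in E i]))).
    apply: le_haar => _ [x Xx [y Ny <-]].
    by have [i _ Ei] := XNE (x, y) (conj Xx Ny); exists i => //; exists (x, y).
  apply: le_trans (haar_bigcup _) _.
  apply: lee_nneseries => [i _ _|i _]; first exact: haar_ge0.
  apply: haar_sumset_le => // u v Eu Ev.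
  apply: (@le_lt_trans _ _ (fine (diam (E i)))); last by rewrite ltrDl.
  by rewrite -lee_fin fineK//; exact: mdist_le_diam.
under eq_eseriesr do rewrite /r EFinD fineK//.
rewrite nneseriesD; [|by move=> *; exact: diam_ge0|by move=> *; rewrite lee_fin ltW].
rewrite [e%:E](_ : _ = (e / 2)%:E + (e / 2)%:E); last by rewrite -EFinD -splitr.
by apply: leeD => //; apply: nneseries_half; rewrite divr_ge0// ltW.
Qed.

End hausdorff.

(** * From additivity to Shelah's condition *)

Section independence.
Context {R : realType}.
Local Open Scope ereal_scope.
Implicit Types (x y z w : cantor_cube) (B : set cantor_cube).
Local Notation haar := (@haar R).

Definition ignores B i :=
  forall z z', (forall j, j != i -> z j = z' j) -> B z -> B z'.

Definition agree w a n : set cantor_cube :=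
  [set z | forall i, (i < n)%N -> z (a + i)%N = w (a + i)%N].

Lemma cantor_clopenI A B : cantor_clopen A -> cantor_clopen B ->
  cantor_clopen (A `&` B).
Proof.
move=> cA cB; rewrite -[A `&` B]setCK setCI; apply: cantor_clopenC.
by apply: cantor_clopenU; exact: cantor_clopenC.
Qed.

Lemma agree_clopen w a n : cantor_clopen (agree w a n).
Proof.
exists (a + n)%N => x y xy xw i ni; rewrite -xy ?xw//.
by rewrite ltn_add2l.
Qed.

Lemma ignoresI A B i : ignores A i -> ignores B i -> ignores (A `&` B) i.
Proof. by move=> iA iB z z' zz' [Az Bz]; split; [exact: iA Az|exact: iB Bz]. Qed.

Lemma ignoresC B i : ignores B i -> ignores (~` B) i.
Proof.
move=> iB z z' zz' nBz Bz'; apply: nBz; apply: iB Bz' => j ji.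
by rewrite zz'.
Qed.

Lemma ignores_agree w a n j : (j < a)%N || (a + n <= j)%N -> ignores (agree w a n) j.
Proof.
move=> ja z z' zz' zw i ni; rewrite -zz' ?zw//.
apply: contraTneq ja => <-; rewrite negb_or -leqNgt leq_addr -ltnNge.
by rewrite ltn_add2l.
Qed.

(** Flipping coordinate [i] is a translation, and it exchanges the two halves of [B]. *)
Lemma haar_halve B i b : cantor_clopen B -> ignores B i ->
  haar (B `&` [set z | z i = b]) = (2^-1)%:E * haar B.
Proof.
move=> cB iB; pose S c := B `&` [set z : cantor_cube | z i = c].
pose u : cantor_cube := fun j => j == i.
have uS c z : S c z -> S (~~ c) (cantor_add u z).
  move=> [Bz zc]; split; last by rewrite /= /cantor_add /u eqxx -zc.
  by apply: iB Bz => j /negPf ji; rewrite /cantor_add /u ji.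
have SE : haar (S (~~ b)) = haar (S b).
  rewrite -(haar_add u (S b)); congr (haar _); apply/seteqP; split.
    move=> z Sz; exists (cantor_add u z); last exact: cantor_addK.
    by rewrite -[b]negbK; exact: uS.
  by move=> _ [z Sz <-]; exact: uS.
have mi : cantor_clopen [set z : cantor_cube | z i = b].
  by exists i.+1 => x y xy /= <-; rewrite xy.
rewrite -/(S b) (haar_split B (clopen_measurable mi)) -/(S b).
rewrite (_ : B `&` ~` _ = S (~~ b)); last first.
  rewrite /S; congr (_ `&` _); apply/seteqP; split => z /=.
    by move/eqP; rewrite -[RHS]negbK; case: (z i); case: (b).
  by move=> -> /eqP; case: (b).
rewrite SE -(fineK (haar_fin_num (S b))) -EFinD -EFinM; congr EFin.
by field.
Qed.

Lemma haar_agree w a n B : cantor_clopen B ->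
  (forall i, (a <= i < a + n)%N -> ignores B i) ->
  haar (B `&` agree w a n) = (2^-1 ^+ n)%:E * haar B.
Proof.
move=> cB; elim: n => [_|n IH iB].
  rewrite expr0 mul1e (_ : agree w a 0 = setT) ?setIT//.
  by apply/seteqP; split.
have iB' i : (a <= i < a + n)%N -> ignores B i.
  by move=> /andP[ai ia]; apply: iB; rewrite ai addnS ltnS ltnW.
rewrite exprS EFinM -muleA -IH//.
rewrite -(@haar_halve (B `&` agree w a n) (a + n)%N (w (a + n)%N)).
- congr (haar _); apply/seteqP; split => [z [Bz zw]|z [[Bz zw] zn]].
    by split; [split => // i ni|]; apply: zw => //; exact: ltnW.
  by split => // i; rewrite ltnS leq_eqVlt => /predU1P[->//|]; exact: zw.
- exact: cantor_clopenI cB (agree_clopen _ _ _).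
- apply: ignoresI; last by apply: ignores_agree; rewrite leqnn orbT.
  by apply: iB; rewrite leq_addr addnS ltnSn.
Qed.

Lemma haar_disagree w a n B : cantor_clopen B ->
  (forall i, (a <= i < a + n)%N -> ignores B i) ->
  haar (B `&` ~` agree w a n) = (1 - 2^-1 ^+ n)%:E * haar B.
Proof.
move=> cB iB; have := @haar_split R _ B (clopen_measurable (agree_clopen w a n)).
rewrite haar_agree// -(fineK (haar_fin_num B)).
rewrite -(fineK (haar_fin_num (B `&` ~` agree w a n))) -!EFinM -EFinD => -[H].
by congr EFin; lra.
Qed.

Definition block_miss k n (ps : seq (nat * cantor_cube)) : set cantor_cube :=
  [set z | forall p, p \in ps -> ~ agree p.2 (k + n * p.1) n z].

Lemma block_miss_cons k n p ps :
  block_miss k n (p :: ps) = block_miss k n ps `&` ~` agree p.2 (k + n * p.1) n.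
Proof.
apply/seteqP; split => z.
  move=> Mz; split; last by apply: Mz; rewrite mem_head.
  by move=> q qps; apply: Mz; rewrite inE qps orbT.
by move=> [Mz zp] q; rewrite inE => /predU1P[->//|]; exact: Mz.
Qed.

(** Blocks with distinct numbers are disjoint and lie beyond [k], so the conditions are independent
    and each contributes a factor [1 - 2 ^- n]. *)
Lemma haar_block_miss k n y ps : uniq [seq p.1 | p <- ps] ->
  haar (agree y 0 k `&` block_miss k n ps) =
  ((1 - 2^-1 ^+ n) ^+ size ps * 2^-1 ^+ k)%:E.
Proof.
elim: ps => [_|p ps IH /= /andP[pps ups]].
  rewrite expr0 mul1r exprVn -(haar_cylinder k y); congr (haar _).
  by apply/seteqP; split => [z []//|z zy]; split.
rewrite block_miss_cons setIA haar_disagree ?IH//.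
- by rewrite -EFinM exprS mulrA.
- apply: cantor_clopenI; first exact: agree_clopen.
  elim: ps {IH pps ups} => [|q ps IH].
    by exists 0%N => a b _ _ c; rewrite in_nil.
  rewrite block_miss_cons; apply: cantor_clopenI => //.
  exact/cantor_clopenC/agree_clopen.
move=> i /andP[ki ik]; apply: ignoresI.
  by apply: ignores_agree; rewrite add0n (leq_trans _ ki) ?leq_addr ?orbT.
elim: ps pps {IH ups} => [_|q ps IH].
  by move=> a b _ _ c; rewrite in_nil.
rewrite inE negb_or => /andP[pq /IH ips]; rewrite block_miss_cons.
apply: ignoresI => //; apply: ignoresC; apply: ignores_agree.
move: ki ik; rewrite -!addnA -!mulnSr => ki ik.
have [pq'|qp|E] := ltngtP p.1 q.1; last by rewrite E eqxx in pq.
  by rewrite (leq_trans ik)// leq_add2l leq_mul2l pq' orbT.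
by rewrite (leq_trans _ ki) ?orbT// leq_add2l leq_mul2l qp orbT.
Qed.

Lemma haar_le_agree (S : set cantor_cube) k (c : R) : (0 <= c)%R ->
  (forall y, haar (S `&` agree y 0 k) <= (c * 2^-1 ^+ k)%:E) -> haar S <= c%:E.
Proof.
move=> c0 Sc.
apply: (@le_trans _ _ (haar (\big[setU/set0]_(t <- enum {: k.-tuple bool})
    (S `&` agree (cantor_ext t) 0 k)))).
  apply: le_haar => z Sz; rewrite -bigcup_seq.
  have szz : size (prefix_of z k) == k by rewrite size_prefix_of.
  exists (Tuple szz); first by rewrite /= mem_enum.
  by split => // i ik; rewrite add0n /cantor_ext nth_mkseq.
apply: le_trans (haar_bigcup_seq _ _) _.
apply: (@le_trans _ _ (\sum_(t <- enum {: k.-tuple bool}) (c * 2^-1 ^+ k)%:E)).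
  exact: lee_sum.
rewrite sumEFin big_const_seq count_predT iter_addr_0 -cardE card_tuple card_bool.
by rewrite -mulrnAr -mulr_natr natrX exprVn mulVf ?mulr1// expf_neq0.
Qed.

End independence.

Lemma uniq_map_coarser (T : Type) (U V : eqType) (f : T -> U) (g : T -> V) s :
  (forall a b, g a = g b -> f a = f b) -> uniq (map f s) -> uniq (map g s).
Proof.
move=> gf; rewrite !uniq_pairwise !pairwise_map.
by apply: sub_pairwise => a b; apply: contra => /eqP/gf/eqP.
Qed.

(** * Small sets with independent translates *)

Section trap.
Context {R : realType}.
Local Open Scope ereal_scope.
Implicit Types (x y z : cantor_cube) (X : set cantor_cube).
Local Notation haar := (@haar R).

(* The prefix of [z] selects a block of [n] coordinates beyond [k], on which [z]
   has to vanish. Translates of this set by points with distinct prefixes of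
   length [k] constrain [z], whose prefix is fixed, on disjoint blocks, so they
   are independent whatever the points look like beyond [k]. *)
Definition trap k n : set cantor_cube :=
  [set z | agree (fun=> false) (k + n * choice.pickle (prefix_of z k)) n z].

Lemma prefix_of_agree x y k : prefix_of x k = prefix_of y k <-> agree y 0 k x.
Proof. exact: prefix_ofP. Qed.

Lemma trap_clopen k n : cantor_clopen (trap k n).
Proof.
pose c := (\max_(t : k.-tuple bool) choice.pickle (val t))%N.
exists (k + n * c.+1)%N => x y xy tx i ni.
have pxy : prefix_of x k = prefix_of y k.
  by apply/prefix_ofP => j jk; apply: xy; rewrite (leq_trans jk) ?leq_addr.
rewrite -pxy -xy; first exact: tx.
rewrite -addnA ltn_add2l mulnSr -addnS leq_add// leq_mul2l; apply/orP; right.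
have szx : size (prefix_of x k) == k by rewrite size_prefix_of.
exact: (leq_bigmax (Tuple szx)).
Qed.

Lemma haar_trap k n : haar (trap k n) <= (2^-1 ^+ n)%:E.
Proof.
apply: (@haar_le_agree _ _ k) => [|y]; first by rewrite exprn_ge0.
rewrite EFinM -[X in (X ^+ k)%:E]mul1r mul1r.
have -> : (2^-1 ^+ k)%:E = haar (agree y 0 k).
  by rewrite exprVn -(haar_cylinder k y).
rewrite -(@haar_agree _ (fun=> false) (k + n * choice.pickle (prefix_of y k))).
- by apply: le_haar => z [tz zy]; split => //; have /prefix_of_agree <- := zy.
- exact: agree_clopen.
- move=> i /andP[ki _]; apply: ignores_agree.
  by rewrite add0n (leq_trans _ ki) ?leq_addr ?orbT.
Qed.

Lemma haar_miss_trap k n (xs : seq cantor_cube) :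
  uniq [seq prefix_of x k | x <- xs] ->
  haar [set z | forall x, x \in xs -> ~ trap k n (cantor_add x z)] <=
  ((1 - 2^-1 ^+ n) ^+ size xs)%:E.
Proof.
move=> uxs; apply: (@haar_le_agree _ _ k) => [|y].
  by rewrite exprn_ge0// subr_ge0 exprn_ile1 ?invf_le1 ?ler1n.
(* For [z] with the prefix of [y], the trap translated by [x] reads the block numbered by the prefix
   of [x + y], and requires [z] to agree with [x] there. *)
pose ps := [seq (choice.pickle (prefix_of (cantor_add x y) k), x) | x <- xs].
rewrite -(size_map (fun x => (choice.pickle (prefix_of (cantor_add x y) k), x)) xs).
rewrite -(@haar_block_miss R k n y).
  apply: le_haar => z [xz zy]; split => // _ /mapP[x xxs ->] /= xzn.
  apply: (xz x xxs) => i ni; rewrite /cantor_add.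
  rewrite (_ : prefix_of _ k = prefix_of (cantor_add x y) k).
    by rewrite xzn// addbb.
  apply/prefix_ofP => j jk; congr (_ (+) _).
  by have := zy j jk; rewrite add0n.
rewrite -map_comp; apply: uniq_map_coarser uxs => x x' /= /(pcan_inj choice.pickleK).
move=> /prefix_ofP xx'; apply/prefix_ofP => i /xx'.
by rewrite /cantor_add => /addIb.
Qed.

Lemma prefix_cover_or_uniq X k b :
  (exists s : seq (seq bool), (size s <= b)%N /\
     forall x, X x -> prefix_of x k \in s) \/
  (exists xs : seq cantor_cube, [/\ size xs = b.+1,
     (forall x, x \in xs -> X x) & uniq [seq prefix_of x k | x <- xs]]).
Proof.
elim: b => [|b [[s [sb Xs]]|[xs [xsb xsX uxs]]]].
- have [->|/set0P[x Xx]] := eqVneq X set0; first by left; exists [::].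
  by right; exists [:: x]; split => // y; rewrite inE => /eqP ->.
- by left; exists s; split => //; exact: leqW.
- have [H|] := pselect (forall x, X x -> prefix_of x k \in [seq prefix_of x k | x <- xs]).
    by left; exists [seq prefix_of x k | x <- xs]; rewrite size_map xsb.
  move=> /existsNP[x /not_implyP[Xx /negP xxs]]; right; exists (x :: xs).
  split; [by rewrite /= xsb| |by rewrite /= xxs].
  by move=> y; rewrite inE => /predU1P[->//|]; exact: xsX.
Qed.

(** Supplies the bound [h n] on the number of prefixes, which depends on [n] and not on [g]. *)
Lemma exists_power_lt n : exists h, ((1 - 2^-1 ^+ n) ^+ h < n.+1%:R^-1 :> R)%R.
Proof.
have n0 : (0 < n.+1%:R^-1 :> R)%R by rewrite invr_gt0.
have p1 : (2^-1 ^+ n <= 1 :> R)%R by rewrite exprn_ile1 ?invf_le1 ?ler1n.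
have q0 : (0 <= 1 - 2^-1 ^+ n :> R)%R by rewrite subr_ge0.
have q1 : (`|1 - 2^-1 ^+ n| < 1 :> R)%R.
  by rewrite ger0_norm// gtrDl oppr_lt0 exprn_gt0.
have /cvgrPdist_lt/(_ _ n0)[h _ /(_ h (leqnn h))] := cvg_expr q1.
by rewrite sub0r normrN ger0_norm ?exprn_ge0//; exists h.
Qed.

End trap.

(** * Decomposition of an additive set into countably many pieces with few prefixes *)

Section shelah.
Context {R : realType}.
Local Open Scope ereal_scope.
Implicit Types (x y z : cantor_cube) (X K : set cantor_cube) (s : seq bool).
Local Notation haar := (@haar R).

Definition cone s : set cantor_cube := [set z | prefix_of z (size s) = s].

(* A Baire category argument in the closed set [K], with sets of measure [0] in
   place of relatively nowhere dense ones. *)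
Lemma positive_part_avoids (F T : (set cantor_cube)^nat) :
  let K := ~` \bigcup_i F i in
  (forall i, cantor_clopen (F i)) -> (forall n, cantor_clopen (T n)) ->
  0 < haar K -> K `&` lim_sup_set T = set0 ->
  exists s m, 0 < haar (K `&` cone s) /\
    forall n, (m <= n)%N -> haar (K `&` cone s `&` T n) = 0.
Proof.
move=> K clF clT K0 KT; apply: contrapT => none.
(* If the claim fails, every word whose cone meets [K] in positive measure extends to a longer one
   with the same property whose cone lies inside some [T n] with [n] past the given index. *)
have /choice[f fP] (sm : seq bool * nat) : exists s', 0 < haar (K `&` cone sm.1) ->
    [/\ 0 < haar (K `&` cone s'), (sm.2 < size s')%N, seq.prefix sm.1 s' &
        exists2 n, (sm.2 <= n)%N & cone s' `<=` T n].
  case: sm => s m /=; have [Ks|nKs] := pselect (0 < haar (K `&` cone s)); last first.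
    by exists [::].
  have [n mn sTn] : exists2 n, (m <= n)%N & haar (K `&` cone s `&` T n) != 0.
    apply: contrapT => H; apply: none; exists s, m; split => // n mn.
    by apply/eqP; apply: contrapT => /negP Tn; apply: H; exists n.
  have [L TL] := clT n; pose l := maxn L (maxn (size s) m.+1).
  have [y Sy] : exists y, 0 < haar (K `&` cone s `&` T n `&` agree y 0 l).
    apply: contrapT => H; move/negP: sTn; apply.
    rewrite eq_le haar_ge0 andbT; apply: (@haar_le_agree _ _ l) => // y.
    by rewrite mul0r leNgt; apply/negP => Sy; apply: H; exists y.
  have [z [[[Kz zs] Tz] zy]] : K `&` cone s `&` T n `&` agree y 0 l !=set0.
    by apply/set0P; apply: contraTneq Sy => ->; rewrite measure0 ltxx.
  have zyl : prefix_of z l = prefix_of y l by exact/prefix_of_agree.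
  exists (prefix_of z l) => _; rewrite size_prefix_of; split.
  - apply: lt_le_trans Sy _; apply: le_haar => w [[[Kw _] _] wy]; split => //.
    by rewrite /cone /= size_prefix_of zyl; exact/prefix_of_agree.
  - by rewrite /l !leq_max ltnSn !orbT.
  - rewrite prefixE take_prefix_of ?zs//.
    by rewrite /l !leq_max leqnn orbT.
  - exists n => // w; rewrite /cone /= size_prefix_of => /prefix_ofP wz.
    apply: TL Tz => i iL; rewrite wz// (leq_trans iL)// /l leq_max leqnn//.
pose S := fix S k := if k is k.+1 then f (S k, k) else [::].
have SK k : 0 < haar (K `&` cone (S k)).
  elim: k => [|k IH]; first by rewrite (_ : K `&` _ = K)//; apply/setIidPl.
  by have [] := fP (S k, k) IH.
have Sp k l : (k <= l)%N -> seq.prefix (S k) (S l).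
  move=> /subnKC <-; elim: (l - k)%N => [|d IH]; first by rewrite addn0 prefix_refl.
  rewrite addnS; apply: prefix_trans IH _.
  by have [_ _ +] := fP (S (k + d)%N, (k + d)%N) (SK _).
have szS k : (k <= size (S k))%N.
  by case: k => // k; have [_ +] := fP (S k, k) (SK k).
(* The limit of the iterated extensions; as [S i.+1] has length at least [i.+1], the default letter
   is never read. *)
pose z : cantor_cube := fun i => nth false (S i.+1) i.
have zS k : cone (S k) z.
  apply: (@eq_from_nth _ false); rewrite size_prefix_of// => i ik.
  rewrite nth_mkseq// /z.
  have [/Sp|/ltnW/Sp] := leqP i.+1 k; rewrite prefixE => /eqP <-.
    by rewrite nth_take.
  by rewrite nth_take.
(* If a clopen [F i] contained [z], it would contain a whole [cone (S l)], but this cone meets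
   [K]. *)
have Kz : K z.
  move=> [i _ Fz]; have [l Fl] := clF i.
  have := SK l; rewrite (_ : K `&` _ = set0) ?measure0 ?ltxx//.
  rewrite -subset0 => w [Kw wS]; apply: Kw; exists i => //.
  apply: Fl Fz => j jl; move: wS (zS l); rewrite /cone /= => <-.
  by rewrite size_prefix_of => /prefix_ofP ->//; rewrite (leq_trans jl).
suff : (K `&` lim_sup_set T) z by rewrite KT.
split => // k _.
have [_ _ _ [n kn Tn]] := fP (S k, k) (SK k).
by exists n => //; apply: Tn; exact: (zS k.+1).
Qed.

Lemma N_additive_narrow X : N_additive R X -> narrow X.
Proof.
move=> addX; have /choice[h hP] := @exists_power_lt R.
apply: (@narrow_bigcup _ h) => g.
pose A n := trap (g n) n.
have N0 : haar (lim_sup_set A) = 0.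
  apply: haar_lim_sup_set => [n|]; first exact: trap_clopen.
  apply: (@le_lt_trans _ _ 2%:E); last exact: ltry.
  apply: le_trans (nneseries_half _) => //.
  apply: lee_nneseries => [n _ _|n _]; first exact: haar_ge0.
  apply: le_trans (haar_trap _ _) _; rewrite lee_fin expnS natrM invfM mulrA.
  by rewrite mulfV// mul1r natrX exprVn.
have /addX/haar_nullP XN0 : haar_null R (lim_sup_set A) by exact/haar_nullP.
have [F [clF XNF F1]] : exists F : (set cantor_cube)^nat,
    [/\ (forall i, cantor_clopen (F i)), sumset X (lim_sup_set A) `<=` \bigcup_i F i &
     \sum_(i <oo) haar (F i) < 1].
  by apply: haar_cover; rewrite XN0 lte_fin.
(* A closed set missing the sumset; its measure is positive because the [F i] have total measure
   below 1. *)
pose K := ~` \bigcup_i F i.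
have K0 : 0 < haar K.
  rewrite lt0e haar_ge0 andbT; apply/eqP => K0.
  have : haar setT < 1.
    rewrite (@haar_split R (\bigcup_i F i)); last first.
      by apply: bigcupT_measurable => i; exact: clopen_measurable.
    by rewrite !setTI -/K K0 adde0 (le_lt_trans _ F1)//; exact: haar_bigcup.
  by rewrite haarT ltxx.
pose T x n := [set z | A n (cantor_add x z)].
have TE x n : T x n = cantor_add x @` A n.
  apply/seteqP; split => [z Az|_ [z Az <-]]; last by rewrite /T/= cantor_addK.
  by exists (cantor_add x z) => //; exact: cantor_addK.
have clT x n : cantor_clopen (T x n).
  by rewrite TE; apply: cantor_add_clopen; exact: trap_clopen.
(* Each point of [X] is sorted by a pair that [positive_part_avoids] yields for it; there are
   countably many pairs. *)
pose Z (sm : seq bool * nat) := [set x | [/\ X x, 0 < haar (K `&` cone sm.1) &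
  forall n, (sm.2 <= n)%N -> haar (K `&` cone sm.1 `&` T x n) = 0]].
exists (fun i => if choice.unpickle i is Some sm then Z sm else set0); split.
  move=> x Xx; have [|s [m [Ks sT]]] := positive_part_avoids clF (clT x) K0.
    rewrite -subset0 => z [Kz Tz]; apply: Kz; apply: XNF.
    exists x => //; exists (cantor_add x z); last exact: cantor_addK.
    by move=> J _; have [j Jj] := Tz J I; exists j.
  by exists (choice.pickle (s, m)) => //; rewrite choice.pickleK.
move=> i; case: (choice.unpickle i) => [[s m]|]; last by exists 0%N => j _; exists [::].
have [Ks|Ks] := pselect (0 < haar (K `&` cone s)); last first.
  by exists 0%N => j _; exists [::]; split => // x [].
have [M KM] : exists M : nat, (M.+1%:R^-1)%:E < haar (K `&` cone s).
  rewrite -(fineK (haar_fin_num (K `&` cone s))).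
  have k0 : (0 < fine (haar (K `&` cone s)))%R.
    by rewrite fine_gt0// Ks (le_lt_trans (haar_le1 _))// ltry.
  exists (Num.trunc (fine (haar (K `&` cone s)))^-1).
  by rewrite lte_fin invf_plt ?posrE// truncnS_gt.
exists (maxn m M) => n; rewrite geq_max => /andP[mn Mn].
(* With more than [h n] prefixes, [K] would meet [cone s] in measure at most [(1 - 2 ^- n) ^ h n],
   which is below [1 / n.+1] and hence below [1 / M.+1], against the choice of [M]. *)
have [//|[xs [szxs xsZ uxs]]] := prefix_cover_or_uniq (Z (s, m)) (g n) (h n).
exfalso; move: KM; apply/negP; rewrite -leNgt.
pose E := [set z | forall x, x \in xs -> ~ A n (cantor_add x z)].
have KE : K `&` cone s `<=` E `|` \big[setU/set0]_(x <- xs) (K `&` cone s `&` T x n).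
  move=> z Kz; have [Ez|] := pselect (E z); first by left.
  move=> /existsNP[x /not_implyP[xxs /contrapT Tz]]; right.
  by rewrite -bigcup_seq; exists x.
apply: le_trans (le_haar KE) _; apply: le_trans (haarU2 _ _) _.
apply: (@le_trans _ _ (((1 - 2^-1 ^+ n) ^+ size xs)%:E + 0)).
  apply: leeD; first exact: haar_miss_trap.
  apply: le_trans (haar_bigcup_seq _ _) _.
  by rewrite big_seq big1// => x /xsZ[_ _ /(_ n mn)].
rewrite adde0 lee_fin szxs.
apply: (@le_trans _ _ ((1 - 2^-1 ^+ n) ^+ h n)%R).
  have p1 : (2^-1 ^+ n <= 1 :> R)%R by rewrite exprn_ile1 ?invf_le1 ?ler1n.
  by apply: ler_wiXn2l; rewrite ?subr_ge0 ?gerBl ?exprn_ge0.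
by rewrite (le_trans (ltW (hP n)))// lef_pV2 ?posrE// ler_nat.
Qed.

End shelah.

(** * Packing dimension *)

Section dimensions.
Context {R : realType}.
Local Open Scope ereal_scope.

Lemma unif_continuous_mdist (U V : metricType R) (f : U -> V) :
  unif_continuous f <-> forall e : R, (0 < e)%R -> exists2 d : R, (0 < d)%R &
    forall x y, (mdist x y < d)%R -> (mdist (f x) (f y) < e)%R.
Proof.
rewrite /unif_continuous -!(@entourage_from_ballE R); split => [fuc e e0|fuc E].
  have [|d d0 dE] := fuc [set xy | ball xy.1 e xy.2]; first by exists e.
  exists d => // x y xy; have := dE (x, y).
  by rewrite /= !ballEmdist/=; apply.
move=> [e e0 eE]; have [d d0 dE] := fuc e e0; exists d => //= -[x y] /=.
rewrite ballEmdist/= => /dE xy; apply: eE.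
by rewrite /= ballEmdist.
Qed.

Lemma at_right0P (V : set R) : (0 : R)%R^'+ V <->
  exists2 e : R, (0 < e)%R & forall y, (0 < y < e)%R -> V y.
Proof.
split=> [/nbhs_ballP[e /= e0 eV]|[e e0 eV]].
  exists e => // y /andP[y0 ye]; apply: eV => //=.
  by rewrite /ball/= sub0r normrN gtr0_norm.
apply/nbhs_ballP; exists e => //= y.
rewrite /ball/= sub0r normrN => ye y0; apply: eV.
by rewrite y0/= (le_lt_trans (ler_norm _)).
Qed.

Lemma covering_number_ge1 (T : metricType R) (A : set T) (d : R) : A !=set0 ->
  1 <= covering_number d A.
Proof.
move=> [x Ax]; apply: le_ereal_inf_tmp => _ [n [E [_ AE]] <-].
rewrite lee_fin; case: n E AE => [|n] E AE; last by rewrite ler1n.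
by have [[]] := AE x Ax.
Qed.

Lemma upper_box_dim_ge0 (T : metricType R) (A : set T) : 0 <= upper_box_dim A.
Proof.
rewrite /upper_box_dim; case: ifPn => // /set0P A0.
apply: limf_esup_ge0 => [/at_right0P[e e0]|d].
  by move=> /(_ (e / 2)%R); apply; lra.
by rewrite mule_ge0 ?inve_ge0// lne_ge0 covering_number_ge1.
Qed.

Lemma upper_packing_dim_ge0 (T : metricType R) (A : set T) :
  0 <= upper_packing_dim A.
Proof.
apply: le_ereal_inf_tmp => _ [E _ <-].
apply: (le_trans (upper_box_dim_ge0 (E 0%N))).
by apply: ereal_sup_ubound; exists 0%N.
Qed.

Lemma covering_number_le (T : metricType R) (A : set T) (d : R) (n : nat)
  (E : 'I_n -> set T) : (forall i, diam (E i) <= d%:E) -> A `<=` \bigcup_i E i ->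
  covering_number d A <= n%:R%:E.
Proof.
by move=> Ed AE; apply: ereal_inf_lbound; exists n => //; exists E.
Qed.

(* With [j] the integer part of [Num.sqrt (- ln d)], the [j.+1] sets have diameter
   at most [d], and [ln j.+1 <= Num.sqrt (- ln d)]. *)
Lemma upper_box_dim_eq0 (T : metricType R) (A : set T) J :
  (forall j, (J <= j)%N -> exists E : 'I_j.+1 -> set T,
    (forall i, diam (E i) <= (expR (- j.+1%:R ^+ 2))%:E) /\ A `<=` \bigcup_i E i) ->
  upper_box_dim A = 0.
Proof.
move=> AJ; apply/eqP; rewrite eq_le upper_box_dim_ge0 andbT.
rewrite /upper_box_dim; case: ifPn => // /set0P A0.
apply/lee_addgt0Pr => e e0; rewrite add0e.
(* For [d] below [exp (- m ^ 2)] the root [r] exceeds [m], which gives both [J <= j] and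
   [1 <= e * r]. *)
pose m := (e^-1 + J%:R)%R.
have m0 : (0 < m)%R by rewrite ltr_pwDl ?invr_gt0.
apply: (@le_trans _ _ (ereal_sup ((fun d : R =>
    lne (covering_number d A) / `|ln d|%:E) @` [set d | 0 < d < expR (- m ^+ 2)]%R))).
  apply: ereal_inf_lbound; exists [set d | 0 < d < expR (- m ^+ 2)]%R => //.
  by apply/at_right0P; exists (expR (- m ^+ 2)) => //; exact: expR_gt0.
apply: ge_ereal_sup => _ [d /andP[d0 dm] <-].
have Lm : (m ^+ 2 < - ln d)%R by rewrite ltrNr -(expRK (- m ^+ 2)%R) ltr_ln ?posrE ?expR_gt0.
have L0 : (0 < - ln d)%R by rewrite (le_lt_trans _ Lm)// exprn_ge0// ltW.
have -> : `|ln d|%R = (- ln d)%R by rewrite -normrN gtr0_norm.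
set r := Num.sqrt (- ln d).
have rE : (r ^+ 2 = - ln d)%R by rewrite sqr_sqrtr// ltW.
have mr : (m < r)%R by rewrite -(ltr_pXn2r (n:=2))// ?nnegrE ?sqrtr_ge0 ?ltW// rE.
have r0 : (0 < r)%R by rewrite (lt_trans m0).
pose j := Num.trunc r.
have /andP[jr rj] : (j%:R <= r < j.+1%:R)%R by exact/truncn_itv/ltW.
have Jj : (J <= j)%N.
  rewrite -ltnS -(ltr_nat R) (le_lt_trans _ rj)// (le_trans _ (ltW mr))//.
  by rewrite lerDr invr_ge0 ltW.
have [E [Ed AE]] := AJ j Jj.
have Nj : covering_number d A <= j.+1%:R%:E.
  apply: covering_number_le AE => i; apply: le_trans (Ed i) _.
  rewrite lee_fin -[leRHS](lnK d0) ler_expR lerNl -rE.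
  by rewrite ler_pXn2r ?nnegrE// ltW.
rewrite inver gt_eqF// lee_pdivrMr//.
apply: (@le_trans _ _ r%:E); last first.
  rewrite -EFinM lee_fin -rE expr2 mulrA ler_peMl ?(ltW r0)//.
  rewrite -(mulfV (lt0r_neq0 e0)) ler_pM2l// (le_trans _ (ltW mr))//.
  by rewrite lerDl.
apply: (@le_trans _ _ (lne j.+1%:R%:E)).
  rewrite lee_lne// in_itv/= leey andbT//.
  by rewrite (le_trans _ (covering_number_ge1 _ A0)).
rewrite lne_EFin// lee_fin (le_trans _ jr)// -natr1 addrC.
by apply: le_ln1Dx; rewrite (lt_le_trans (ltrN10 R)).
Qed.

Lemma narrow_P_null (X : set cantor_cube) : narrow X -> @P_null R (set_type X).
Proof.
move=> nX Y f /unif_continuous_mdist fuc.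
have /choice[g gP] j : exists n, forall a b : X,
    prefix_of (val a) n = prefix_of (val b) n ->
    (mdist (f a) (f b) <= expR (- j.+1%:R ^+ 2) :> R)%R.
  have [d d0 dP] := fuc _ (expR_gt0 (- j.+1%:R ^+ 2)%R).
  have [n nd] := half_power_lt d0; exists n => a b ab; apply/ltW/dP.
  by apply: le_lt_trans nd; exact: (cantor_dist_prefix ab).
have [P [szP XP]] := nX g.
apply/eqP; rewrite eq_le upper_packing_dim_ge0 andbT.
pose Z J := f @` [set a : X | forall j, (J <= j)%N -> prefix_of (val a) (g j) \in P j].
apply: (@le_trans _ _ (ereal_sup [set upper_box_dim (Z J) | J in setT])).
  apply: ereal_inf_lbound; exists Z => // _ [a _ <-].
  by have [J aP] := XP (val a) (set_valP a); exists J => //; exists a.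
apply: ge_ereal_sup => _ [J _ <-]; rewrite (@upper_box_dim_eq0 _ (Z J) J)// => j Jj.
(* Indices past the end of [P j] yield the default word, whose set obeys the same diameter bound. *)
exists (fun i => f @` [set a : X | prefix_of (val a) (g j) = nth [::] (P j) i]).
split=> [i|_ [a aP <-]].
  apply: diam_le => [|_ _ [a ai <-] [b bi <-]]; first exact: expR_ge0.
  by apply: gP; rewrite ai bi.
have aj := aP j Jj.
have ij : (index (prefix_of (val a) (g j)) (P j) < j.+1)%N.
  by rewrite (leq_trans _ (szP j))// index_mem.
by exists (Ordinal ij) => //; exists a => //=; rewrite nth_index.
Qed.

End dimensions.

(* The cube with a metric in which points at distance less than [2^-1 ^+ k] have
   the same prefix of length [g k]. *)
Definition slow_cube (R : realType) (g : nat -> nat) : Type := cantor_cube.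

HB.instance Definition _ (R : realType) (g : nat -> nat) :=
  Choice.copy (slow_cube R g) cantor_cube.

Section slow_metric.
Context {R : realType} (g : nat -> nat).
Implicit Types x y z : slow_cube R g.

(* The maximum makes distinct points lie at a positive distance. *)
Definition slow_prefix x k : seq bool := prefix_of x (maxn (g k) k.+1).

Definition slow_dist x y : R :=
  if pselect (exists k : nat, slow_prefix x k != slow_prefix y k) is left h
  then 2^-1 ^+ ex_minn h else 0.

Lemma slow_dist_ge0 x y : 0 <= slow_dist x y.
Proof. by rewrite /slow_dist; case: pselect => // h; rewrite exprn_ge0. Qed.

Lemma slow_dist_ge x y k :
  slow_prefix x k != slow_prefix y k -> 2^-1 ^+ k <= slow_dist x y.
Proof.
move=> xy; rewrite /slow_dist; case: pselect => [h|[]]; last by exists k.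
case: ex_minnP => m _ /(_ k xy) mk.
by apply: ler_wiXn2l; rewrite ?invf_le1 ?ler1n.
Qed.

Lemma slow_distxx x : slow_dist x x = 0.
Proof.
by rewrite /slow_dist; case: pselect => // h; exfalso; case: h => k; rewrite eqxx.
Qed.

Lemma slow_dist_positivity x y : slow_dist x y = 0 -> x = y.
Proof.
move=> xy0; apply/funext => i.
have /eqP/prefix_ofP : slow_prefix x i == slow_prefix y i.
  apply: contrapT => /negP/slow_dist_ge; rewrite xy0; apply/negP.
  by rewrite -ltNge exprn_gt0.
by apply; rewrite leq_max ltnSn orbT.
Qed.

Lemma slow_dist_sym x y : slow_dist x y = slow_dist y x.
Proof.
wlog suff : x y / slow_dist x y <= slow_dist y x.
  by move=> H; apply/eqP; rewrite eq_le !H.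
rewrite {1}/slow_dist; case: pselect => [h|_]; last exact: slow_dist_ge0.
by case: ex_minnP => m xy _; apply: slow_dist_ge; rewrite eq_sym.
Qed.

Lemma slow_dist_triangle y x z : slow_dist x z <= slow_dist x y + slow_dist y z.
Proof.
rewrite {1}/slow_dist; case: pselect => [h|_]; last first.
  by rewrite addr_ge0 ?slow_dist_ge0.
case: ex_minnP => m xz _.
have [xy|/slow_dist_ge xy] := eqVneq (slow_prefix x m) (slow_prefix y m).
  by rewrite xy in xz; rewrite (le_trans (slow_dist_ge xz))// lerDr slow_dist_ge0.
by rewrite (le_trans xy)// lerDl slow_dist_ge0.
Qed.

HB.instance Definition _ := isMetric.Build R (slow_cube R g)
  slow_distxx slow_dist_positivity slow_dist_sym slow_dist_triangle.

Lemma slow_mdist_lt x y k :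
  mdist x y < 2^-1 ^+ k :> R -> prefix_of x (g k) = prefix_of y (g k).
Proof.
move=> xy; have : slow_prefix x k == slow_prefix y k.
  by apply: contrapT => /negP/slow_dist_ge; rewrite leNgt xy.
move=> /eqP/(congr1 (take (g k))).
by rewrite !take_prefix_of ?leq_maxl.
Qed.

Lemma slow_unif_continuous (X : set cantor_cube) :
  unif_continuous (fun a : X => val a : slow_cube R g).
Proof.
apply/unif_continuous_mdist => e e0; have [n ne] := half_power_lt e0.
(* Only the finitely many slow prefixes of index at most [n] matter for a distance bound of
   [2 ^- n], and a common prefix of this length makes them agree. *)
exists (2^-1 ^+ \max_(k < n.+1) maxn (g k) k.+1); first by rewrite exprn_gt0.
move=> a b /cantor_dist_lt ab; apply: le_lt_trans ne.
change (slow_dist (val a) (val b) <= 2^-1 ^+ n).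
rewrite /slow_dist; case: pselect => [h|_]; last by rewrite exprn_ge0.
case: ex_minnP => m abm _; apply: ler_wiXn2l; rewrite ?invf_le1 ?ler1n//.
rewrite leqNgt; apply: contra abm => mn; apply/eqP/prefix_ofP => i im.
apply: ab; apply: leq_trans (ltnW im) _.
by apply: (@leq_bigmax _ (fun k : 'I_n.+1 => maxn (g k) k.+1) (Ordinal (leqW mn))).
Qed.

End slow_metric.

(** For small [d] the quotient of logarithms is below 1, so the covering number is below [1 / d];
    this is used with [d = 2 ^- j.+1]. *)
Lemma upper_box_dim_lt1 (R : realType) (T : metricType R) (A : set T) :
  (upper_box_dim A < 1)%E -> exists J, forall j, (J <= j)%N ->
    exists n (E : 'I_n -> set T), [/\ (n <= 2 ^ j.+1)%N,
      (forall i, (diam (E i) <= (2^-1 ^+ j.+1)%:E)%E) & A `<=` \bigcup_i E i].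
Proof.
rewrite /upper_box_dim; case: ifPn => [/eqP -> _|/set0P A0].
  exists 0%N => j _; exists 0%N, (fun=> set0); split => // i.
  by apply: diam_le => //; rewrite exprn_ge0.
move=> /ereal_inf_lt[_ [V /at_right0P[e e0 eV] <-] V1].
have [J Je] := half_power_lt e0; exists J => j Jj.
set d : R := 2^-1 ^+ j.+1.
have d0 : 0 < d by rewrite exprn_gt0.
have d1 : d < 1 by rewrite exprn_ilt1 ?invf_lt1 ?ltr1n.
have de : d < e.
  apply: lt_trans Je; rewrite lt_half_exp//.
have := le_lt_trans (ereal_sup_ubound (imageP _ (eV d _))) V1; rewrite d0 de => /(_ isT).
have L0 : 0 < - ln d by rewrite oppr_gt0 ln_lt0// d0.
have -> : `|ln d| = - ln d by rewrite -normrN gtr0_norm.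
rewrite inver gt_eqF// lte_pdivrMr// mul1e -lnV// -lne_EFin ?invr_gt0//.
rewrite lte_lne ?in_itv/= ?leey ?andbT ?lee_fin ?invr_ge0 ?ltW//; last first.
  exact: lt_le_trans (covering_number_ge1 _ A0).
move=> /ereal_inf_lt[_ [n [E [Ed AE]] <-]].
rewrite lte_fin => nd; exists n, E; split => //.
by rewrite ltnW// -(ltr_nat R) natrX -[ltRHS]invrK -exprVn.
Qed.

(** A set of diameter at most [2 ^- j.+1], strictly below [2 ^- j], in the slow metric has a single
    prefix of length [g j]. So [2 ^ j.+1] words suffice for each piece, and this bound is
    independent of [g]. *)
Lemma P_null_narrow (R : realType) (X : set cantor_cube) :
  @P_null R (set_type X) -> narrow X.
Proof.
move=> nX; apply: (@narrow_bigcup _ (fun j => 2 ^ j.+1)%N) => g.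
have := nX (slow_cube R g) _ (@slow_unif_continuous R g X).
move=> dim0; have : (upper_packing_dim (range (fun a : X => val a : slow_cube R g)) < 1)%E.
  by rewrite dim0 lte_fin.
move=> /ereal_inf_lt[_ [Z XZ <-] Z1].
exists Z; split=> [x Xx|m]; first by apply: XZ; exists (SigSub (mem_set Xx)).
have [|J JE] := @upper_box_dim_lt1 R (slow_cube R g) (Z m).
  by apply: le_lt_trans Z1; apply: ereal_sup_ubound; exists m.
exists J => j /JE[n [E [nj Ed ZE]]].
(* One point of each covering set represents its common prefix; an empty set contributes the prefix
   of a default point. *)
exists [seq prefix_of (xget (point : cantor_cube) (E i)) (g j) | i <- enum 'I_n].
split=> [|x /ZE[i _ Eix]]; first by rewrite size_map size_enum_ord.
apply/mapP; exists i; first by rewrite mem_enum.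
apply: (@slow_mdist_lt R g).
have Eiy : E i (xget (point : cantor_cube) (E i)) by apply: xgetPex; exists x.
rewrite -lte_fin; apply: le_lt_trans (mdist_le_diam Eix Eiy) _.
by apply: le_lt_trans (Ed i) _; rewrite lte_fin lt_half_exp.
Qed.

Theorem theorem9p1 (R : realType) (X : set cantor_cube) :
  [<-> @P_null R (set_type X);
       N_additive R X;
       sharply_N_additive R X;
       forall N : set cantor_cube, haar_null R N ->
         @hausdorff1 R (cantor_cube * cantor_cube)%type (X `*` N) = 0%E].
Proof.
tfae.
- by move=> /P_null_narrow/narrow_sharply_N_additive/sharply_N_additiveW.
- by move=> /N_additive_narrow; exact: narrow_sharply_N_additive.
- move=> /sharply_N_additiveW/N_additive_narrow nX N; exact: narrow_hausdorff1.
- by move=> /hausdorff1_N_additive/N_additive_narrow; exact: narrow_P_null.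
Qed.
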